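(* Let $V$ be a $2n$-dimensional vector space over a field $F$, let $\Omega: V\times V\to F$ be a non-degenerate symplectic form, and let $k\in\{1,\dots,n-1\}$. If $n\neq 2k$ and $\max(k,n-k)\geq 5$, then any bijective transformation $f$ of ${\mathfrak H}_{k}(\Omega)$ preserving the class of base subsets is induced by an element of $\Gamma{\rm Sp}(\Omega)$; that is, there exists $l\in\Gamma{\rm Sp}(\Omega)$ such that $f(U)=l(U)$ for every $U\in{\mathfrak H}_{k}(\Omega)$.
   Context: Two subspaces $S,T\subset V$ are orthogonal, $S\perp T$, if $\Omega(x,y)=0$ for all $x\in S$, $y\in T$. A subspace $S\subset V$ is non-degenerate if the restriction $\Omega|_{S}$ is non-degenerate. ${\mathfrak H}_{k}(\Omega)$ is the set of all $2k$-dimensional non-degenerate subspaces of $V$. Base subsets. A symplectic base is a set $B=\{P_1,\dots,P_{2n}\}$ of $1$-dimensional subspaces of $V$ whose sum is $V$ (a base of the projective space of $V$) such that for each $i\in\{1,\dots,2n\}$ there is a unique $\sigma(i)\in\{1,\dots,2n\}$ with $P_i\not\perp P_{\sigma(i)}$. The set ${\mathfrak S}_1=\{P_i+P_{\sigma(i)}: i=1,\dots,2n\}=\{S_1,\dots,S_n\}$ (which consists of $n$ mutually orthogonal elements of ${\mathfrak H}_1(\Omega)$) is the base subset of ${\mathfrak H}_1(\Omega)$ associated with $B$. For $k\in\{2,\dots,n-1\}$ the base subset of ${\mathfrak H}_k(\Omega)$ defined by ${\mathfrak S}_1$ is the set ${\mathfrak S}_k$ of all sums $S_{i_1}+\dots+S_{i_k}$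 with $i_1,\dots,i_k$ distinct. A bijection $f$ of ${\mathfrak H}_{k}(\Omega)$ to itself preserves the class of base subsets if both $f$ and $f^{-1}$ send base subsets of ${\mathfrak H}_{k}(\Omega)$ to base subsets of ${\mathfrak H}_{k}(\Omega)$. $\Gamma{\rm Sp}(\Omega)$ is the group of semi-linear automorphisms of $V$ preserving $\Omega$.
   Formalization: ''Preserving Ω'' for elements of ΓSp(Ω) is taken up to a nonzero constant c: Ω(l(x),l(y)) = c·σ(Ω(x,y)); with c = 1 the claim fails, e.g. over the rationals with n = 6, k = 1 for the map e_i→2e_i, f_i→f_i. *)

(* Defs.v *)
From mathcomp Require Import all_boot all_order all_algebra.
From mathcomp Require Import boolp classical_sets functions.

Set Implicit Arguments.
Unset Strict Implicit.
Unset Printing Implicit Defensive.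

Import GRing.Theory.
Local Open Scope classical_set_scope.
Local Open Scope ring_scope.

Section SymplecticGrassmannian.
Variables (F : fieldType) (V : vectType F) (Omega : {skew_symmetric V}).
Implicit Types (S T U : {vspace V}) (k n : nat).

Definition perp S T : Prop := {in S & T, forall x y, Omega x y = 0}.

Definition nondegenerate_on S : Prop :=
  {in S, forall x, {in S, forall y, Omega x y = 0} -> x = 0}.

Definition Hset k : set {vspace V} :=
  [set U | \dim U = (2 * k)%N /\ nondegenerate_on U].

Definition symplectic_base n (P : 'I_(2 * n) -> {vspace V}) : Prop :=
  [/\ injective P,
      forall i, \dim (P i) = 1%N,
      (\sum_i P i)%VS = fullv
    & forall i, exists! j, ~ perp (P i) (P j)].

Definition base_subset1 n (P : 'I_(2 * n) -> {vspace V}) : set {vspace V} :=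
  [set S | exists i j, ~ perp (P i) (P j) /\ S = (P i + P j)%VS].

Definition sums_of k (S1 : set {vspace V}) : set {vspace V} :=
  [set U | exists T : 'I_k -> {vspace V},
     [/\ injective T, forall i, S1 (T i) & U = (\sum_i T i)%VS]].

(* Since sums_of 1 S1 = S1, the case k = 1 needs no separate clause. *)
Definition is_base_subset n k (A : set {vspace V}) : Prop :=
  exists P : 'I_(2 * n) -> {vspace V},
    symplectic_base P /\ A = sums_of k (base_subset1 P).

(* Only the values of f on Hset k matter; for f a bijection of Hset k,
   Hset k `&` f @^-1` A is the image of A under the inverse bijection. *)
Definition preserves_base_subsets n k (f : {vspace V} -> {vspace V}) : Prop :=
  (forall A, is_base_subset n k A -> is_base_subset n k (f @` A)) /\
  (forall A, is_base_subset n k A ->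
     is_base_subset n k (Hset k `&` f @^-1` A)).

(* Semi-symplectic automorphisms: a semi-linear automorphism preserves Omega
   up to its field automorphism sigma and a nonzero multiplier c. Requiring
   c = 1 would exclude similitudes, which also act on Hset k and on its base
   subsets, but in general are not scalar multiples of an isometry. *)
Definition GammaSp (l : V -> V) : Prop :=
  exists sigma : {rmorphism F -> F},
    [/\ bijective sigma, bijective l, linear_for (sigma \; *:%R) l
      & exists2 c : F, c != 0 &
          forall x y, Omega (l x) (l y) = c * sigma (Omega x y)].

End SymplecticGrassmannian.

(* Main.v *)
(* Call hyperbolic lines the elements of H_1. A base subset of H_k consists of
   the sums S_I of k of the lines of a decomposition V = S_1 + ... + S_n into
   mutually orthogonal hyperbolic lines. A family of elements S_I lies in a
   second base subset iff it fails to separate two indices i and j: then S_i and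
   S_j can be replaced by another decomposition of S_i + S_j. This property is
   preserved by f, so f respects which pairs {i, j} are separated by I; as n is
   not 2k, on each base subset f is induced by a bijection between the lines of
   two decompositions. If N is a sum of j + 1 <= min(k, n - k) lines and its
   image does not depend on the decomposition used, the same holds for sums of j
   lines, because orthogonality is connected (of diameter 2) on the hyperbolic
   lines of the orthogonal complement, whose rank is at least 4. At j = 1 this
   gives a bijection of H_1 preserving orthogonality. Orthogonality determines
   when a line is contained in the span of two others, hence when two lines meet,
   hence the pencils of lines through a point; so one obtains a bijection of
   points preserving orthogonality, thus collinearity, to which the fundamental
   theorem of projective geometry applies. *)
Require Import Defs.
From HB Require Import structures.
From mathcomp Require Import all_boot all_order all_algebra.
From mathcomp Require Import boolp classical_sets functions.
From mathcomp Require Import zify ring fintype finset.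

Set Implicit Arguments.
Unset Strict Implicit.
Unset Printing Implicit Defensive.

Import GRing.Theory.
Local Open Scope ring_scope.


(** Two coincidences explain the numerical hypotheses. A set of indices and its complement separate
    the same pairs, so separation determines a permutation only up to complementation; for n = 2k
    the map sending U to its orthogonal complement realises this ambiguity. The bound 5 enters where
    pairs are added over F_2: three disjoint pairs add up to zero on all k-sets when n = 6 and k is
    even, and for n = 6 the bound leaves only k = 1 and k = 5. It also makes room for the descent,
    which starts from sums of k lines or, after taking orthogonal complements, from sums of n - k
    lines, with a starting number of at most n - 4.

    Nothing is known beforehand about incidence or orthogonality of the images of elements of H_k.
    Subspaces are therefore handled through index sets of a frame, and orthogonality enters only
    because two orthogonal lines lie in a common frame. Points carry no scale either: the linear
    structure is recovered on an affine chart, and the multiplier in [GammaSp] is the scalar that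
    orthogonality cannot see. *)

(** * Linear algebra of a non-degenerate symplectic form *)

Section SymplecticSpace.
Variables (F : fieldType) (V : vectType F) (Omega : {skew_symmetric V}).
Hypothesis symplO : is_psymplectic Omega.
Implicit Types (U W X S T : {vspace V}) (x y z : V).

Local Notation "U ^!" := (orthov Omega U) : vspace_scope.

(* Restatements on [Omega] itself: the generic lemmas produce terms headed by
   another coercion path, on which later rewriting fails. *)
Lemma formDl x y z : Omega (x + y) z = Omega x z + Omega y z.
Proof. exact: linearDl. Qed.

Lemma formDr x y z : Omega z (x + y) = Omega z x + Omega z y.
Proof. exact: linearDr. Qed.

Lemma formZl a x y : Omega (a *: x) y = a * Omega x y.
Proof. exact: linearZl_LR. Qed.

Lemma formZr a x y : Omega x (a *: y) = a * Omega x y.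
Proof. exact: linearZr_LR. Qed.

Lemma formBl x y z : Omega (x - y) z = Omega x z - Omega y z.
Proof. exact: linearBl. Qed.

Lemma formC x y : Omega y x = - Omega x y.
Proof. by rewrite (hermC Omega) /= expr1 mulN1r. Qed.

Lemma form_eq0C x y : (Omega y x == 0) = (Omega x y == 0).
Proof. by rewrite formC oppr_eq0. Qed.

(** Skew-symmetry gives 2 Omega(x, x) = 0; in characteristic 2 alternation is a clause of
    [is_psymplectic]. *)
Lemma form_alt x : Omega x x = 0.
Proof.
have [_ _ char2] := symplO.
have [/char2 //|odd_char] := boolP (2%N \in [pchar F]).
have /eqP := formC x x; rewrite -addr_eq0 -mulr2n -mulr_natr mulf_eq0.
case/orP=> /eqP // two0.
by case/negP: odd_char; rewrite inE /= two0 eqxx.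
Qed.

Lemma ex_form_neq0 : (0 < \dim {:V})%N -> exists x y, Omega x y != 0.
Proof.
rewrite lt0n dimv_eq0 -vpick0 => x0; have [rad0 _ _] := symplO.
have : vpick {:V} \notin (fullv^!)%VS by rewrite (eqP rad0) memv0.
by case/mem_orthovPn => y _ xy; exists (vpick {:V}), y.
Qed.

Lemma perpP S T : perp Omega S T <-> (S <= T^!)%VS.
Proof. by split=> [/orthovP|/orthovP]. Qed.

Lemma perpC S T : perp Omega S T -> perp Omega T S.
Proof. by move=> ST x y xT yS; rewrite formC ST ?oppr0. Qed.

Lemma mem_orthov_line x y : (x \in (<[y]>^!)%VS) = (Omega x y == 0).
Proof. exact: mem_orthov1. Qed.

(** Each vector of a basis of [U] imposes one linear condition on [X]. *)
Lemma dim_cap_orthov X U : (\dim X <= \dim (X :&: U^!) + \dim U)%N.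
Proof.
rewrite -(span_basis (vbasisP U)).
have -> : \dim <<vbasis U>> = size (vbasis U).
  by apply/eqP; exact: basis_free (vbasisP U).
elim: (tval (vbasis U)) X => [|u s IHs] X /=.
  by rewrite span_nil orthov0 capvf addn0.
rewrite span_cons; have -> : ((<[u]> + <<s>>)^! = <[u]>^! :&: <<s>>^!)%VS.
  apply/eqP; rewrite eqEsubv subv_cap; apply/andP; split.
    by rewrite -orthovD subvv.
  by rewrite orthovD capvSl capvSr.
rewrite capvA addnS -addSn.
have le1 : (\dim X <= \dim (X :&: <[u]>^!)%VS + 1)%N.
  have := leq_dim_orthov1 Omega u X; rewrite addn1; lia.
by apply: leq_trans le1 _; rewrite addn1 addSn ltnS IHs.
Qed.

(** One inequality counts conditions on [fullv]. For the other, a vector orthogonal to [U] and to a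
    complement of [U] lies in the radical, so dim U^! is at most the dimension of that
    complement. *)
Lemma dim_orthov U : (\dim (U^!) + \dim U = \dim {:V})%N.
Proof.
have [rad0 _ _] := symplO.
have /= := dim_cap_orthov (U^!)%VS (U^C)%VS.
have -> : (U^! :&: U^C^! = 0)%VS.
  by apply/eqP; rewrite -subv0 -(eqP rad0) -(addv_complf U) orthovD capvSl capvSr.
rewrite dimv0 dimv_compl.
have := dim_cap_orthov fullv U; rewrite capfv.
have := dimvS (subvf U); lia.
Qed.

Lemma orthovK U : (U^!^! = U)%VS.
Proof.
apply/eqP; rewrite eq_sym eqEdim orthov_sym subvv /=.
have := dim_orthov U; have := dim_orthov (U^!)%VS; lia.
Qed.

Lemma orthovS U W : (U <= W)%VS -> (W^! <= U^!)%VS.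
Proof. by move=> UW; rewrite orthov_sym (subv_trans UW) // orthov_sym. Qed.

Lemma nondegenerate_onP U : nondegenerate_on Omega U <-> (U :&: U^! = 0)%VS.
Proof.
split=> [nd|cap0 x xU xP].
  apply/eqP; rewrite -subv0; apply/subvP => x /memv_capP[xU /mem_orthovP xP].
  by rewrite memv0; apply/eqP/nd.
apply/eqP; rewrite -memv0 -cap0 memv_cap xU.
by apply/mem_orthovP.
Qed.

Lemma nondegenerate_on_cap0 U : nondegenerate_on Omega U -> (U :&: U^! = 0)%VS.
Proof. by move/nondegenerate_onP. Qed.

Lemma nondegenerate_on_orthov U :
  nondegenerate_on Omega U -> nondegenerate_on Omega (U^!)%VS.
Proof. by rewrite !nondegenerate_onP orthovK capvC. Qed.

Lemma dim_pair x y : x != 0 -> y \notin <[x]>%VS -> \dim (<[x]> + <[y]>) = 2%N.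
Proof.
move=> x0 xy; rewrite dimv_disjoint_sum ?dim_vline ?x0.
  by case: eqVneq xy => // ->; rewrite mem0v.
apply/eqP; rewrite -subv0; apply/subvP => z /memv_capP[/vlineP[a ->] /vlineP[b ab]].
rewrite memv0 ab scaler_eq0; case: eqVneq => //= b0.
case/negP: xy; apply/vlineP; exists (b^-1 * a).
by rewrite -scalerA ab scalerA mulVf // scale1r.
Qed.

Lemma dimv2P S : \dim S = 2%N -> forall x y, x \in S -> y \in S ->
  y \notin <[x]>%VS -> x != 0 -> S = (<[x]> + <[y]>)%VS.
Proof.
move=> dS x y xS yS xy x0; apply/esym/eqP.
by rewrite eqEdim subv_add -!memvE xS yS /= dim_pair // dS.
Qed.

Lemma form_neq0_l x y : Omega x y != 0 -> x != 0.
Proof. by apply: contraNneq => ->; rewrite linear0l. Qed.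

Lemma form_neq0_notin x y : Omega x y != 0 -> y \notin <[x]>%VS.
Proof.
by apply: contraNN => /vlineP[a ->]; rewrite formZr /= form_alt mulr0.
Qed.

Local Notation hline := (Hset Omega 1).

Lemma mem_pairl x y : x \in (<[x]> + <[y]>)%VS.
Proof. by rewrite (subvP (addvSl _ _)) // memv_line. Qed.

Lemma mem_pairr x y : y \in (<[x]> + <[y]>)%VS.
Proof. by rewrite (subvP (addvSr _ _)) // memv_line. Qed.

Lemma hline_pair x y : Omega x y != 0 -> hline (<[x]> + <[y]>)%VS.
Proof.
move=> xy; split.
  by rewrite dim_pair ?(form_neq0_l xy) // form_neq0_notin.
move=> z /memv_addP[u /vlineP[a ->] [v /vlineP[b ->] ->]] zP.
have := zP y (mem_pairr x y); have := zP x (mem_pairl x y).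
rewrite !formDl !formZl /= !form_alt !mulr0 add0r addr0 formC.
move/eqP; rewrite mulf_eq0 oppr_eq0 (negPf xy) orbF => /eqP ->.
move/eqP; rewrite mulf_eq0 (negPf xy) orbF => /eqP ->.
by rewrite !scale0r addr0.
Qed.

Lemma hline_partner S x : hline S -> x \in S -> x != 0 ->
  exists2 y, y \in S & Omega x y != 0.
Proof.
move=> [_ nd] xS x0; apply/exists2P; apply: contrapT => no.
case/negP: x0; apply/eqP/(nd _ xS) => y yS.
by apply/eqP; apply: contrapT => /negP xy; apply: no; exists y.
Qed.

Lemma hline_eq S x y : hline S -> x \in S -> y \in S -> Omega x y != 0 ->
  S = (<[x]> + <[y]>)%VS.
Proof.
move=> [dS _] xS yS xy.
by apply: dimv2P; rewrite ?(form_neq0_l xy) // form_neq0_notin.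
Qed.

Lemma hline_neq0 S : hline S -> exists2 x, x \in S & x != 0.
Proof.
move=> [dS _]; exists (vpick S); first exact: memv_pick.
by rewrite vpick0 -dimv_eq0 dS.
Qed.

Lemma hline_ex S : hline S ->
  exists x y, [/\ x \in S, y \in S & Omega x y != 0].
Proof.
move=> hS; have [x xS x0] := hline_neq0 hS.
by have [y yS xy] := hline_partner hS xS x0; exists x, y.
Qed.

Lemma hline_form S x y : hline S -> x \in S -> y \in S -> x != 0 ->
  y \notin <[x]>%VS -> Omega x y != 0.
Proof.
move=> hS xS yS x0 xy; have [z zS xz] := hline_partner hS xS x0.
have [dS _] := hS.
move: zS; rewrite (dimv2P dS xS yS xy x0) => /memv_addP[_ /vlineP[a ->]].
case=> _ /vlineP[b ->] z_def; move: xz.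
by rewrite z_def formDr !formZr /= form_alt mulr0 add0r mulf_eq0; case/norP.
Qed.

Lemma nondegenerate_hline W : nondegenerate_on Omega W -> W != 0%VS ->
  exists2 S, hline S & (S <= W)%VS.
Proof.
move=> nd W0; pose x := vpick W.
have xW : x \in W by exact: memv_pick.
have x0 : x != 0 by rewrite vpick0.
have [[y yW xy]|no] := pselect (exists2 y, y \in W & Omega x y != 0).
  by exists (<[x]> + <[y]>)%VS; [exact: hline_pair | rewrite subv_add -!memvE xW yW].
case/negP: x0; apply/eqP/(nd _ xW) => y yW.
by apply/eqP; apply: contrapT => /negP xy; apply: no; exists y.
Qed.

Lemma nondegenerate_onD U W : nondegenerate_on Omega U ->
  nondegenerate_on Omega W -> (U <= W^!)%VS ->
  nondegenerate_on Omega (U + W)%VS /\ \dim (U + W) = (\dim U + \dim W)%N.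
Proof.
move=> ndU ndW UW; split; last first.
  apply: dimv_disjoint_sum; apply/eqP; rewrite -subv0 -(nondegenerate_on_cap0 ndW).
  by rewrite capvC capvS.
move=> _ /memv_addP[u uU [w wW ->]] P.
have WU : (W <= U^!)%VS by rewrite orthov_sym.
have u0 : u = 0.
  apply: (ndU _ uU) => y yU; have := P y; rewrite formDl.
  rewrite [Omega w y](mem_orthovP (subvP WU _ wW) _ yU) addr0.
  by apply; rewrite (subvP (addvSl _ _)).
have w0 : w = 0.
  apply: (ndW _ wW) => y yW; have := P y; rewrite formDl.
  rewrite (mem_orthovP (subvP UW _ uU) _ yW) add0r.
  by apply; rewrite (subvP (addvSr _ _)).
by rewrite u0 w0 addr0.
Qed.

Lemma not_isotropic_hline X : ~~ (X <= X^!)%VS -> exists2 S, hline S & (S <= X)%VS.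
Proof.
case/subvPn => x xX; case/mem_orthovPn => y yX xy.
by exists (<[x]> + <[y]>)%VS; [exact: hline_pair | rewrite subv_add -!memvE xX].
Qed.

(* A totally isotropic subspace of the nondegenerate space Y^! has at most
   half its dimension, whereas C^! cuts out codimension at most 2. *)
Lemma ex_hline_orthov (Y C : {vspace V}) : nondegenerate_on Omega Y ->
  (\dim Y + 6 <= \dim {:V})%N -> (\dim C <= 2)%N ->
  exists2 S, hline S & (S <= Y^! :&: C^!)%VS.
Proof.
move=> ndY dY dC; apply: not_isotropic_hline; apply/negP.
set X := (Y^! :&: C^!)%VS => isoX.
have := dim_orthov X; have := dim_cap_orthov (Y^!)%VS C; rewrite -/X.
have := dim_orthov Y; have : (X + Y <= X^!)%VS.
  by rewrite subv_add isoX orthov_sym capvSl.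
move/dimvS; rewrite dimv_disjoint_sum; first lia.
apply/eqP; rewrite -subv0 -(nondegenerate_on_cap0 ndY) capvC capvS //.
exact: capvSl.
Qed.
End SymplecticSpace.

(** * Orthogonal frames of hyperbolic lines *)

Lemma ex_notin n (I : {set 'I_n}) : (#|I| < n)%N -> exists i, i \notin I.
Proof.
move=> In; have : (0 < #|~: I|)%N by have := cardsC I; rewrite card_ord; lia.
by case/card_gt0P => i; rewrite inE; exists i.
Qed.

Section Frames.
Variables (F : fieldType) (V : vectType F) (Omega : {skew_symmetric V}).
Hypothesis symplO : is_psymplectic Omega.
Variable n : nat.
Hypothesis dimV : \dim {:V} = (2 * n)%N.
Implicit Types (U W X : {vspace V}) (S T Z : 'I_n -> {vspace V}).
Implicit Types (I J K : {set 'I_n}) (i j : 'I_n).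

Local Notation "U ^!" := (orthov Omega U) : vspace_scope.
Local Notation hline := (Hset Omega 1).

Definition sumI S I : {vspace V} := (\sum_(i in I) S i)%VS.

Definition frame_on I S : Prop :=
  {in I, forall i, hline (S i)} /\
  {in I & I, forall i j, i != j -> (S i <= (S j)^!)%VS}.

(* A frame numbers the lines of a base subset of H_1. *)
Definition frame S : Prop := frame_on [set: 'I_n] S.

Lemma frame_hline S i : frame S -> hline (S i).
Proof. by case=> hS _; apply: hS; rewrite in_setT. Qed.

Lemma frame_perp S i j : frame S -> i != j -> (S i <= (S j)^!)%VS.
Proof. by case=> _ oS ij; apply: oS; rewrite ?in_setT. Qed.

Lemma sumI_sub S I i : i \in I -> (S i <= sumI S I)%VS.
Proof. by move=> iI; rewrite (sumv_sup i). Qed.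

Lemma sumIS S I J : I \subset J -> (sumI S I <= sumI S J)%VS.
Proof. by move/subsetP=> IJ; apply/subv_sumP => i /IJ; apply: sumI_sub. Qed.

Lemma sumIU S I J : sumI S (I :|: J) = (sumI S I + sumI S J)%VS.
Proof.
apply/eqP; rewrite eqEsubv subv_add !sumIS ?subsetUl ?subsetUr //= andbT.
apply/subv_sumP => i /setUP[] iI; apply: subv_trans (sumI_sub S iI) _.
  exact: addvSl.
exact: addvSr.
Qed.

Lemma eq_sumI S T I : {in I, S =1 T} -> sumI S I = sumI T I.
Proof. by move=> ST; apply: eq_bigr. Qed.

Lemma sumI1 S i : sumI S [set i]%SET = S i.
Proof. by rewrite /sumI big_set1. Qed.

Lemma sumI_setU1 S I i : sumI S (i |: I)%SET = (S i + sumI S I)%VS.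
Proof. by rewrite sumIU sumI1. Qed.

Lemma sumI_orthov S I X : {in I, forall i, S i <= X^!}%VS -> (sumI S I <= X^!)%VS.
Proof. by move=> SX; apply/subv_sumP. Qed.

Lemma frame_onS I J S : J \subset I -> frame_on I S -> frame_on J S.
Proof.
by move/subsetP=> JI [hS oS]; split=> [i /JI|i j /JI iI /JI]; [apply: hS|apply: oS].
Qed.

Lemma frame_frame_on S I : frame S -> frame_on I S.
Proof. exact/frame_onS/subsetT. Qed.

Lemma frame_on_sum I S : frame_on I S ->
  nondegenerate_on Omega (sumI S I) /\ \dim (sumI S I) = (2 * #|I|)%N.
Proof.
have [m] := ubnP #|I|; elim: m I => // m IHm I leIm fS.
have [->|[i iI]] := set_0Vmem I.
  rewrite /sumI big_set0 cards0 dimv0 muln0; split=> // x.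
  by rewrite memv0 => /eqP.
have JI : I :\ i \subset I by exact: subD1set.
have [|nd dJ] := IHm (I :\ i)%SET _ (frame_onS JI fS).
  by rewrite (cardsD1 i) iI in leIm.
have [fh fo] := fS; have [di ndi] := fh i iI.
rewrite -[in sumI S I](setD1K iI) sumI_setU1 [#|I|](cardsD1 i) iI mulnDr -dJ -di.
apply: nondegenerate_onD => //; rewrite orthov_sym; apply: sumI_orthov => j.
by rewrite !inE => /andP[ji jI]; apply: fo.
Qed.

Lemma frame_nondeg S I : frame S -> nondegenerate_on Omega (sumI S I).
Proof. by move=> fS; case: (frame_on_sum (frame_frame_on I fS)). Qed.

Lemma frame_dim S I : frame S -> \dim (sumI S I) = (2 * #|I|)%N.
Proof. by move=> fS; case: (frame_on_sum (frame_frame_on I fS)). Qed.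

Lemma frame_full S : frame S -> sumI S [set: 'I_n] = fullv.
Proof.
move=> fS; apply/eqP; rewrite eqEdim subvf frame_dim // dimV.
by rewrite cardsT card_ord leqnn.
Qed.

Lemma frame_orthov S I : frame S -> (sumI S I)^!%VS = sumI S (~: I).
Proof.
move=> fS; apply/esym/eqP; rewrite eqEdim frame_dim //.
have -> : (sumI S (~: I) <= (sumI S I)^!)%VS.
  rewrite orthov_sym; apply: sumI_orthov => i iI.
  rewrite orthov_sym; apply: sumI_orthov => j.
  rewrite inE => jI; apply: (frame_perp fS); by apply: contraNneq jI => ->.
have := dim_orthov symplO (sumI S I); rewrite frame_dim //.
have := cardsC I; rewrite card_ord dimV /=; lia.
Qed.

(** By duality: each sum is the orthogonal complement of the sum over the complementary index set,
    which turns the intersection into a union of indices. *)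
Lemma frame_cap S I J : frame S -> (sumI S I :&: sumI S J)%VS = sumI S (I :&: J).
Proof.
move=> fS; apply/eqP; rewrite eqEsubv subv_cap.
rewrite !sumIS ?subsetIl ?subsetIr // !andbT.
rewrite -[I in X in (_ <= X)%VS]setCK -[J in X in (_ <= X)%VS]setCK.
rewrite -setCU -frame_orthov // sumIU -!frame_orthov //.
by rewrite orthovD !(orthovK symplO) capvSl capvSr.
Qed.

Lemma frame_sumI_inj S : frame S -> injective (sumI S).
Proof.
move=> fS I J IJ; apply/eqP.
have dIJ : #|I :&: J| = #|I|.
  have := frame_dim (I :&: J) fS; rewrite -frame_cap // -IJ capvv frame_dim //; lia.
have dJ : #|I| = #|J|.
  have := frame_dim I fS; rewrite IJ frame_dim //; lia.
rewrite eqEcard dJ leqnn andbT; apply/setIidPl/eqP.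
by rewrite eqEcard subsetIl dIJ leqnn.
Qed.

Lemma frame_inj S : frame S -> injective S.
Proof.
move=> fS i j; rewrite -!sumI1 => /(frame_sumI_inj fS).
by move/setP/(_ i); rewrite !inE eqxx => /esym/eqP.
Qed.

Lemma frame_notperp S I i X : frame S -> (X <= sumI S I)%VS ->
  ~~ (X <= (S i)^!)%VS -> i \in I.
Proof.
move=> fS XI; apply: contraNT => iI; apply: subv_trans XI _.
rewrite orthov_sym -[X in (X <= _)%VS]sumI1 frame_orthov //.
by apply: sumIS; rewrite sub1set inE.
Qed.

Lemma frame_perp_others S i X : frame S ->
  (forall j, j != i -> (X <= (S j)^!)%VS) -> (X <= S i)%VS.
Proof.
move=> fS XS; have -> : S i = (sumI S (~: [set i]%SET))^!%VS.
  by rewrite frame_orthov // setCK sumI1.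
rewrite orthov_sym; apply: sumI_orthov => j; rewrite !inE => ji.
by rewrite orthov_sym XS.
Qed.

Lemma hline_le_eq X W : hline X -> hline W -> (X <= W)%VS -> X = W.
Proof. by move=> [dX _] [dW _] XW; apply/eqP; rewrite eqEdim XW dX dW. Qed.

Definition updf S a X := fun i => if i == a then X else S i.

Lemma updf_eq S a X : updf S a X a = X.
Proof. by rewrite /updf eqxx. Qed.

Lemma updf_neq S a X i : i != a -> updf S a X i = S i.
Proof. by rewrite /updf => /negPf ->. Qed.

Lemma updf_sumI S a X I : a \notin I -> sumI (updf S a X) I = sumI S I.
Proof.
move=> aI; apply: eq_sumI => i iI; rewrite updf_neq //.
by apply: contraNneq aI => <-.
Qed.

Lemma frame_on_updf S I a X : frame_on I S -> a \notin I -> hline X ->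
  (X <= (sumI S I)^!)%VS -> frame_on (a |: I)%SET (updf S a X).
Proof.
move=> [hS oS] aI hX XI.
have na i : i \in I -> i != a by move=> iI; apply: contraNneq aI => <-.
have XSi i : i \in I -> (X <= (S i)^!)%VS.
  by move=> iI; apply: subv_trans XI (orthovS _ (sumI_sub S iI)).
split=> [i|i j]; rewrite !inE.
  case/orP=> [/eqP->|iI]; first by rewrite updf_eq.
  by rewrite updf_neq ?na //; apply: hS.
case/orP=> [/eqP->|iI] /orP[/eqP->|jI]; rewrite ?eqxx // ?updf_eq.
- by rewrite updf_neq ?na // => _; apply: XSi.
- by rewrite updf_neq ?na // => _; rewrite orthov_sym; apply: XSi.
- by rewrite !updf_neq ?na // => ij; apply: oS.
Qed.

(** Induction on the number of missing indices: the orthogonal complement of the sum over [I] is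
    non-degenerate and nonzero, so it contains a further hyperbolic line. The values of [S] off [I]
    are discarded. *)
Lemma frame_extend I S : frame_on I S -> exists2 T, frame T & {in I, T =1 S}.
Proof.
have [m] := ubnP #|~: I|; elim: m I S => // m IHm I S leIm fS.
have [I0|[a aI]] := set_0Vmem (~: I)%SET.
  exists S => //; move: fS; rewrite -[I]setCK I0 => fS.
  by apply: frame_onS fS; rewrite setC0.
have [ndI dI] := frame_on_sum fS.
have ndP := nondegenerate_on_orthov symplO ndI.
have [|X hX XI] := nondegenerate_hline symplO ndP.
  rewrite -dimv_eq0; have := dim_orthov symplO (sumI S I); rewrite dI dimV.
  have := cardsC I; rewrite card_ord /=.
  have : (0 < #|~: I|)%N by apply/card_gt0P; exists a.
  by rewrite -lt0n; move: (\dim _) #|~: I| #|I| => d c e; lia.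
have aI' : a \notin I by rewrite inE in aI.
have [|T fT TS] := IHm (a |: I)%SET (updf S a X) _ (frame_on_updf fS aI' hX XI).
  suff : #|~: (a |: I)|%SET.+1 = #|~: I| by lia.
  rewrite setCU [#|~: I|](cardsD1 a) aI add1n; congr _.+1.
  by apply: eq_card => i; rewrite !inE.
exists T => // i iI; rewrite TS ?inE ?iI ?orbT //.
by rewrite updf_neq //; apply: contraNneq aI' => <-.
Qed.
End Frames.

(** * Base subsets as families of sums of lines of a frame *)

Section BaseSubsets.
Variables (F : fieldType) (V : vectType F) (Omega : {skew_symmetric V}).
Hypothesis symplO : is_psymplectic Omega.
Variable n : nat.
Hypothesis dimV : \dim {:V} = (2 * n)%N.
Implicit Types (U W X : {vspace V}) (S T Z : 'I_n -> {vspace V}).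
Implicit Types (I J K : {set 'I_n}) (P : 'I_(2 * n) -> {vspace V}).

Local Notation "U ^!" := (orthov Omega U) : vspace_scope.
Local Notation hline := (Hset Omega 1).

Definition ksums k S : set {vspace V} :=
  fun U => exists2 I : {set 'I_n}, #|I| = k & U = sumI S I.

Lemma sums_of_range k S : injective S -> sums_of k (range S) = ksums k S.
Proof.
move=> injS; apply/seteqP; split=> U /=.
  case=> T [injT ST ->]; have [c Tc] : {c & forall i, T i = S (c i)}.
    apply: (@choice _ _ (fun i j => T i = S j)) => i.
    by have [j _ <-] := ST i; exists j.
  have injc : injective c by move=> i j ij; apply: injT; rewrite !Tc ij.
  exists (c @: [set: 'I_k])%SET; first by rewrite card_imset // cardsT card_ord.
  rewrite /sumI big_imset /=; last by move=> i j _ _; apply: injc.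
  by apply: eq_big => [i|i _]; rewrite ?inE ?Tc.
case=> I <- ->; exists (fun i => S (enum_val i)); split.
- by move=> i j /injS /enum_val_inj.
- by move=> i; exists (enum_val i).
- by rewrite /sumI big_enum_val.
Qed.

Lemma perp_line x y : perp Omega <[x]>%VS <[y]>%VS <-> Omega x y = 0.
Proof.
split=> [-> //|xy0]; first exact: memv_line.
  exact: memv_line.
move=> _ _ /vlineP[a ->] /vlineP[b ->].
by rewrite formZl formZr xy0 !mulr0.
Qed.

Lemma symplectic_base_frame S : frame Omega S ->
  exists2 P : 'I_(2 * n) -> {vspace V},
    symplectic_base Omega P & base_subset1 Omega P = range S.
Proof.
move=> fS.
have [v vS] : {v : 'I_n -> V * V & forall i, [/\ (v i).1 \in S i, (v i).2 \in S i
    & Omega (v i).1 (v i).2 != 0]}.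
  apply: (@choice _ _ (fun i w => [/\ w.1 \in S i, w.2 \in S i & Omega w.1 w.2 != 0])).
  by move=> i; have [x [y xy]] := hline_ex (frame_hline i fS); exists (x, y).
(* [d.1] names a line and [d.2] one vector of its hyperbolic pair, so negating the Boolean is the
   involution sigma of the base. *)
pose w (d : 'I_n * bool) := if d.2 then (v d.1).1 else (v d.1).2.
have wS d : w d \in S d.1 by case: d => i []; rewrite /w /=; case: (vS i).
have w_neq0 d : Omega (w d) (w (d.1, ~~ d.2)) != 0.
  case: d => i []; rewrite /w /=; case: (vS i) => _ _ //.
  by rewrite form_eq0C.
have w_eq0 d d' : d' != (d.1, ~~ d.2) -> Omega (w d) (w d') = 0.
  case: d d' => i b [j c] /=; have [<-|ij] := eqVneq i j.
    case: (eqVneq b c) => [<-|bc]; first by rewrite form_alt.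
    by case/negP; apply/eqP; congr (_, _); case: b c bc => [] [].
  move=> _; have := subvP (frame_perp fS ij) _ (wS (i, b)).
  by move/mem_orthovP => /(_ _ (wS (j, c))).
have dE : #|{: 'I_n * bool}| = (2 * n)%N by rewrite card_prod card_ord card_bool mulnC.
pose e (m : 'I_(2 * n)) : 'I_n * bool := enum_val (cast_ord (esym dE) m).
have e_inj : injective e by move=> m m' /enum_val_inj /cast_ord_inj.
have e_surj d : exists m, e m = d.
  exists (cast_ord dE (enum_rank d)); rewrite /e.
  by rewrite (_ : cast_ord _ _ = enum_rank d) ?enum_rankK //; apply: val_inj.
pose P m := <[w (e m)]>%VS.
have wP m m' : ~ perp Omega (P m) (P m') <-> e m' = ((e m).1, ~~ (e m).2).
  split=> [np|mm']; last by rewrite perp_line mm'; apply/eqP/w_neq0.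
  by apply/eqP; apply: contrapT => /negP mm'; apply: np; apply/perp_line/w_eq0.
have sum2 m m' : ~ perp Omega (P m) (P m') -> (P m + P m')%VS = S (e m).1.
  move/wP => mm'; apply/esym/(hline_eq symplO (frame_hline _ fS)); rewrite ?mm' //.
  by have := wS ((e m).1, ~~ (e m).2).
have eS i : exists m m', ~ perp Omega (P m) (P m') /\ e m = (i, true).
  have [m em] := e_surj (i, true); have [m' em'] := e_surj (i, false).
  by exists m, m'; split=> //; apply/wP; rewrite em em'.
exists P; last first.
  apply/seteqP; split=> U /=.
    by case=> m [m' [np ->]]; exists (e m).1 => //; rewrite sum2.
  case=> i _ <-; have [m [m' [np em]]] := eS i.
  by exists m, m'; split=> //; rewrite sum2 // em.
split.
(* A point determines its only non-orthogonal partner, hence its own index. *)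
- move=> m m' mm'; have [m2 em2] := e_surj ((e m).1, ~~ (e m).2).
  have : ~ perp Omega (P m) (P m2) by apply/wP.
  rewrite mm' => /wP; rewrite em2 => -[e1 /negb_inj e2]; apply: e_inj.
  by rewrite [e m]surjective_pairing [e m']surjective_pairing e1 e2.
- by move=> m; rewrite dim_vline (form_neq0_l (w_neq0 (e m))).
- apply/eqP; rewrite eqEsubv subvf -(frame_full dimV fS) /=; apply/subv_sumP => i _.
  have [m [m' [np em]]] := eS i; have := sum2 _ _ np; rewrite em /= => <-.
  by rewrite subv_add (sumv_sup m) ?(sumv_sup m').
- move=> m; have [m' em'] := e_surj ((e m).1, ~~ (e m).2).
  exists m'; split; first by apply/wP.
  by move=> m2 /wP em2; apply: e_inj; rewrite em' em2.
Qed.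

Lemma dimv1P U : \dim U = 1%N -> exists2 x, x != 0 & U = <[x]>%VS.
Proof.
move=> dU; have x0 : vpick U != 0 by rewrite vpick0 -dimv_eq0 dU.
exists (vpick U) => //; apply/esym/eqP; rewrite eqEdim dU dim_vline x0 andbT.
by rewrite -memvE memv_pick.
Qed.

Lemma frame_symplectic_base P : symplectic_base Omega P ->
  exists2 S : 'I_n -> {vspace V}, frame Omega S & base_subset1 Omega P = range S.
Proof.
move=> [injP dP _ exP].
have [s sP] : {s & forall i j, ~ perp Omega (P i) (P j) <-> j = s i}.
  apply: (@choice _ _ (fun i si => forall j, ~ perp Omega (P i) (P j) <-> j = si)).
  by move=> i; have [j [npj uj]] := exP i; exists j => j'; split=> [/uj|->].
have sK i : s (s i) = i.
  apply/esym/sP => psi; have : ~ perp Omega (P i) (P (s i)) by apply/sP.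
  by apply; apply: perpC.
have s_neq i : s i != i.
  apply/eqP => si; have : ~ perp Omega (P i) (P i) by apply/sP.
  have [x _ ->] := dimv1P (dP i); apply.
  by apply/perp_line; rewrite form_alt.
(* [A] takes the smaller index of each pair {i, s i}; as [s] exchanges [A] with its complement, [A]
   has n elements and numbers the lines. *)
pose A := [set i : 'I_(2 * n) | (i < s i)%N]%SET.
have notA i : (i \notin A) = (s i \in A).
  by rewrite !inE sK -leqNgt [RHS]ltn_neqAle s_neq.
have cardA : #|A| = n.
  have sA : ~: A = [set s x | x in A]%SET.
    apply/setP => i; rewrite inE notA; apply/idP/imsetP => [siA|[j jA ->]].
      by exists (s i); rewrite ?sK.
    by rewrite sK.
  have := cardsC A; rewrite sA card_imset ?card_ord; last exact: can_inj sK.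
  lia.
pose e (i : 'I_n) : 'I_(2 * n) := enum_val (cast_ord (esym cardA) i).
have eA i : e i \in A by exact: enum_valP.
have e_inj : injective e by move=> i j /enum_val_inj /cast_ord_inj.
have e_surj a : a \in A -> exists i, e i = a.
  move=> aA; exists (cast_ord cardA (enum_rank_in aA a)); rewrite /e.
  rewrite (_ : cast_ord _ _ = enum_rank_in aA a) ?enum_rankK_in //.
  exact: val_inj.
have s_perp i j : j != s i -> (P i <= (P j)^!)%VS.
  by move=> ji; apply/perpP; apply: contrapT => np; case/eqP: ji; apply/sP.
exists (fun i => P (e i) + P (s (e i)))%VS.
  split=> [i _|i j _ _ ij].
    have : ~ perp Omega (P (e i)) (P (s (e i))) by apply/sP.
    have [x _ ->] := dimv1P (dP (e i)); have [y _ ->] := dimv1P (dP (s (e i))).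
    by move=> np; apply: hline_pair => //; apply/eqP => xy; apply/np/perp_line.
  have eij : e i != e j by apply: contraNneq ij => /e_inj ->.
  have ejs : e j != s (e i).
    by apply: contraTneq (eA j) => ->; rewrite notA sK.
  have eis : s (e j) != e i by apply: contraNneq ejs => <-; rewrite sK.
  have sij : s (e j) != s (e i) by apply: contraNneq eij => /(can_inj sK) ->.
  by rewrite subv_add !orthovD !s_perp ?sK // eq_sym.
apply/seteqP; split=> U /=.
  case=> i [j [/sP -> ->]]; have [iA|] := boolP (i \in A).
    by have [a <-] := e_surj i iA; exists a.
  rewrite notA => iA; have [a ea] := e_surj _ iA; exists a => //.
  by rewrite ea sK addvC.
by case=> i _ <-; exists (e i), (s (e i)); split=> //; apply/sP.
Qed.

Lemma is_base_subsetP k A : is_base_subset Omega n k A <->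
  exists2 S : 'I_n -> {vspace V}, frame Omega S & A = ksums k S.
Proof.
split=> [[P [sbP ->]]|[S fS ->]].
  have [S fS ->] := frame_symplectic_base sbP; exists S => //.
  by rewrite sums_of_range //; apply: frame_inj fS.
have [P sbP PS] := symplectic_base_frame fS; exists P; split=> //.
by rewrite PS sums_of_range //; apply: frame_inj fS.
Qed.
End BaseSubsets.

(** * Recovering a permutation from its action on separated pairs *)

Section SubsetPermutation.
Variable n : nat.
Implicit Types (I J A B : {set 'I_n}) (i j a b c d : 'I_n).

Lemma ex_kset k A B : [disjoint A & B] -> (#|A| <= k)%N -> (k + #|B| <= n)%N ->
  exists I, [/\ A \subset I, [disjoint I & B] & #|I| = k].
Proof.
move=> AB; elim: k => [|k IHk].
  by rewrite leqn0 cards_eq0 => /eqP A0 _; exists A; rewrite A0 cards0; split=> //; rewrite -A0.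
rewrite leq_eqVlt => /orP[/eqP Ak kB|Ak kB]; first by exists A.
have [||I [AI IB Ik]] := IHk; [by []|lia|].
have : (0 < #|~: (I :|: B)|)%N.
  have := cardsC (I :|: B); rewrite card_ord cardsU.
  have -> : I :&: B = finset.set0 by apply/eqP; rewrite setI_eq0.
  by rewrite cards0 Ik; lia.
case/card_gt0P => x; rewrite !inE negb_or => /andP[xI xB].
exists (x |: I)%SET; split.
- by rewrite subsetU // AI orbT.
- rewrite -setI_eq0 setIUl setU_eq0 !setI_eq0 IB andbT.
  by rewrite disjoints1.
- by rewrite cardsU1 xI Ik.
Qed.

(* [sep i j I] says that I contains exactly one of i and j; it is the parity
   on I of [chi i j], so that relations between pairs become linear over F_2. *)
Definition sep i j I := (i \in I) (+) (j \in I).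
Definition chi a b i := (i == a) (+) (i == b).
Definition par (f : 'I_n -> bool) I := \big[addb/false]_(i in I) f i.

Lemma sep_trans i j l I : sep i l I = sep i j I (+) sep j l I.
Proof. by rewrite /sep addbA -(addbA (i \in I)) addbb addbF. Qed.

Lemma par_add f g I : par (fun i => f i (+) g i) I = par f I (+) par g I.
Proof. exact: big_split. Qed.

Lemma par_eq a I : par (fun i => i == a) I = (a \in I).
Proof.
rewrite /par; have [aI|aI] := boolP (a \in I).
  rewrite (bigD1 a) //= eqxx big1 // => i /andP[_]; exact: negbTE.
by rewrite big1 // => i iI; apply: contraNF aI => /eqP <-.
Qed.

Lemma par_chi a b I : par (chi a b) I = sep a b I.
Proof. by rewrite par_add !par_eq. Qed.

Lemma chiC a b : chi a b =1 chi b a.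
Proof. by move=> i; rewrite /chi addbC. Qed.

Lemma par_ext f g I : f =1 g -> par f I = par g I.
Proof. by move=> fg; apply: eq_bigr => i _. Qed.

Section FixedSize.
Variable k : nat.
Hypotheses (k_gt0 : (0 < k)%N) (k_lt : (k < n)%N).

(** Exchanging x for y in a k-set that contains x but not y changes the parity by f(x) + f(y). Such
    a set exists because 0 < k < n. *)
Lemma par_kernel f : (forall I, #|I| = k -> par f I = false) ->
  forall x y, f x = f y.
Proof.
move=> f0 x y; have [-> //|xy] := eqVneq x y.
have [||| I [xI yI Ik]] := @ex_kset k [set x]%SET [set y]%SET.
- by rewrite disjoints1 inE.
- by rewrite cards1.
- by rewrite cards1 addn1.
rewrite finset.sub1set in xI; rewrite disjoint_sym disjoints1 in yI.
have yI' : y \notin I :\ x by rewrite !inE (negPf yI) andbF.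
have := f0 (y |: (I :\ x))%SET; rewrite cardsU1 yI' -Ik (cardsD1 x I) xI => /(_ erefl).
have := f0 _ Ik; rewrite /par -{1}(setD1K xI) !big_setU1 //= ?setD11 //.
by do 2 case: (f _); case: (\big[_/_]_(_ in _) _).
Qed.

Hypothesis (max_ge5 : (5 <= maxn k (n - k))%N).

(** By [par_kernel] the sum of the three pairs is constant. If it were 1, their six points would
    exhaust the index set, so n <= 6; [max_ge5] then leaves n = 6 and k = 1 or 5. But the constant 1
    has parity k on a k-set, and k is odd. *)
Lemma par_chi3 a b c d i j :
  (forall I, #|I| = k -> sep a b I (+) sep c d I (+) sep i j I = false) ->
  forall x, chi a b x (+) chi c d x = chi i j x.
Proof.
move=> s0; pose f x := chi a b x (+) chi c d x (+) chi i j x.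
have parf I : #|I| = k -> par f I = false.
  by move=> Ik; rewrite 2!par_add !par_chi s0.
suff f0 x : f x = false.
  move=> x; have := f0 x; rewrite /f.
  by case: (chi a b x); case: (chi c d x); case: (chi i j x).
have fc := par_kernel parf; case fx : (f x) => //; exfalso.
pose s := [:: a; b; c; d; i; j].
have s_all y : y \in s.
  have : f y by rewrite (fc y x).
  rewrite /f /chi /s !inE.
  by do 6 case: eqVneq => //= _.
have n_le6 : (n <= 6)%N.
  rewrite -[n]card_ord; apply: leq_trans (card_size s).
  by apply/subset_leq_card/fintype.subsetP => y _; exact: s_all.
have k_odd : odd k by case: k k_gt0 k_lt max_ge5 => [|[|[|[|[|[|m]]]]]] //=; lia.
have [||| I [_ _ Ik]] := @ex_kset k finset.set0 finset.set0.
- by rewrite -setI_eq0 setI0.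
- by rewrite cards0.
- by rewrite cards0; lia.
have := parf I Ik; rewrite /par (eq_bigr (fun=> true)) => [|y _]; last by rewrite (fc y x).
rewrite big_const Ik => parT; move: k_odd.
suff -> : odd k = iter k (addb true) false by rewrite parT.
by elim: (k) => //= m ->; case: iter.
Qed.

(** Disjoint pairs add up to four points and equal pairs to none, so two pairs whose sum is a pair
    share exactly one point. *)
Lemma chi_meet a b c d i j : a != b -> c != d -> i != j ->
  (forall x, chi a b x (+) chi c d x = chi i j x) ->
  exists v x y, [/\ chi a b =1 chi v x, chi c d =1 chi v y, v != x, v != y & x != y].
Proof.
move=> ab cd ij m.
have xy v x y : chi a b =1 chi v x -> chi c d =1 chi v y -> x != y.
  move=> mx my; apply: contraNneq ij => exy.
  have := m i; rewrite mx my exy addbb /chi eqxx addTb.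
  by case: eqVneq.
have [ac|ac] := eqVneq a c.
  by exists a, b, d; rewrite -ac in xy cd *; split=> //; apply: (xy a).
have [ad|ad] := eqVneq a d.
  exists a, b, c; rewrite -ad in xy cd m *; split=> //; first exact: chiC.
  by apply: (xy a) => //; apply: chiC.
have [bc|bc] := eqVneq b c.
  exists b, a, d; rewrite -bc in xy cd m *; split=> //; first exact: chiC.
    by rewrite eq_sym.
have [bd|bd] := eqVneq b d.
  exists b, a, c; rewrite -bd in xy cd m *; split=> //; try exact: chiC.
    by rewrite eq_sym.
have ma : chi i j a by rewrite -m /chi eqxx (negPf ab) (negPf ac) (negPf ad).
have mb : chi i j b.
  by rewrite -m /chi eqxx eq_sym (negPf ab) (negPf bc) (negPf bd).
have mc : chi i j c.
  by rewrite -m /chi eqxx ![c == _]eq_sym (negPf ac) (negPf bc) eq_sym (negPf cd).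
have two x : chi i j x -> x = i \/ x = j.
  by rewrite /chi; case: eqVneq => [->|_]; [left | move=> /eqP; right].
have [] := two a ma => ea; have [] := two b mb => eb; have [] := two c mc => ec.
all: by move: ab ac bc; rewrite ea eb ec eqxx.
Qed.

Lemma sep_const_eq i j :
  (forall I, #|I| = k -> sep i j I = false) -> i = j.
Proof.
move=> s0; apply/eqP; apply: contraT => ij.
have [||| I [iI jI Ik]] := @ex_kset k [set i]%SET [set j]%SET.
- by rewrite disjoints1 inE.
- by rewrite cards1.
- by rewrite cards1 addn1.
rewrite finset.sub1set in iI; rewrite disjoint_sym disjoints1 in jI.
by have := s0 I Ik; rewrite /sep iI (negPf jI).
Qed.

(** The sum of three pairs through i has the support {i, j, l, m}, which is neither empty nor
    everything, against [par_kernel]. This excludes triangles among the images of such pairs, since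
    the sides of a triangle add up to zero. *)
Lemma sep_star i j l m : i != j -> i != l -> i != m -> j != l -> j != m -> l != m ->
  ~ (forall I, #|I| = k -> sep i j I (+) sep i l I (+) sep i m I = false).
Proof.
move=> ij il im jl jm lm s0.
pose f x := chi i j x (+) chi i l x (+) chi i m x.
have parf I : #|I| = k -> par f I = false.
  by move=> Ik; rewrite 2!par_add !par_chi s0.
have fc := par_kernel parf; have [x xs] : exists x, x \notin [:: i; j; l; m].
  apply: contrapT => no; have : (#|'I_n| <= size [:: i; j; l; m])%N.
    apply: leq_trans (card_size _); apply/subset_leq_card/fintype.subsetP => y _.
    by apply: contrapT => /negP ys; apply: no; exists y.
  rewrite card_ord /=; move: max_ge5; lia.
have := fc i x; rewrite /f /chi !eqxx (negPf ij) (negPf il) (negPf im).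
move: xs; rewrite !inE !negb_or => /and4P[/negPf -> /negPf -> /negPf -> /negPf ->].
by [].
Qed.

(* The pairs {o, j} through a fixed point o go to pairs that meet two by two,
   since the difference of two of them is again a pair, and no three of which
   form a triangle; hence these have a common point v, and o |-> v and
   j |-> (the other point of the image of {o, j}) is the permutation. It can
   only be off by a complement, which n <> 2k excludes. *)
Lemma ksets_perm (phi psi : {set 'I_n} -> {set 'I_n}) :
  n <> (2 * k)%N ->
  (forall I, #|I| = k -> #|phi I| = k) -> (forall I, #|I| = k -> #|psi I| = k) ->
  (forall I, #|I| = k -> phi (psi I) = I) ->
  (forall i j, i != j -> exists a b, a != b /\
     forall I, #|I| = k -> sep i j I = sep a b (phi I)) ->
  exists2 p : 'I_n -> 'I_n, injective p &
    forall I, #|I| = k -> phi I = p @: I.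
Proof.
move=> n_neq phik psik psiK phi_sep.
have n_gt5 : (5 < n)%N by move: max_ge5; lia.
pose o : 'I_n := Ordinal (ltn_trans (isT : 0 < 5)%N n_gt5).
have to_phi (P : {set 'I_n} -> Prop) : (forall I, #|I| = k -> P (phi I)) ->
    forall J, #|J| = k -> P J.
  by move=> PI J Jk; rewrite -(psiK J Jk); apply/PI/psik.
have [e eP] : {e : 'I_n -> 'I_n * 'I_n & forall j, o != j -> (e j).1 != (e j).2 /\
    forall I, #|I| = k -> sep o j I = sep (e j).1 (e j).2 (phi I)}.
  apply: (@choice _ _ (fun j w => o != j -> w.1 != w.2 /\
    forall I, #|I| = k -> sep o j I = sep w.1 w.2 (phi I))) => j.
  have [oj|oj] := eqVneq o j; first by exists (o, o).
  by have [a [b abP]] := phi_sep _ _ oj; exists (a, b).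
pose E j := chi (e j).1 (e j).2.
have meet j l : o != j -> o != l -> j != l ->
    exists v x y, [/\ E j =1 chi v x, E l =1 chi v y, v != x, v != y & x != y].
  move=> oj ol jl; have [a [b [ab abP]]] := phi_sep _ _ jl.
  have [ej ejP] := eP j oj; have [el elP] := eP l ol.
  apply: (chi_meet ej el ab); apply: par_chi3; apply: to_phi => I Ik.
  by rewrite -ejP // -elP // -abP // /sep; do 3 case: (_ \in I).
have triple j l m : o != j -> o != l -> o != m -> j != l -> j != m -> l != m ->
    ~ (forall x, E j x (+) E l x = E m x).
  move=> oj ol om jl jm lm Ejlm; apply: (sep_star oj ol om jl jm lm) => I Ik.
  rewrite (eP j oj).2 // (eP l ol).2 // (eP m om).2 // -!par_chi -!par_add.
  rewrite (par_ext (g := fun=> false)); first by rewrite /par big1.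
  by move=> x; rewrite -[X in X (+) _]/(E j x (+) E l x) Ejlm addbb.
have lt1 : (1 < n)%N by lia. have lt2 : (2 < n)%N by lia.
pose j1 := Ordinal lt1; pose j2 := Ordinal lt2.
have [v [x [y [Ej1 Ej2 vx vy xy]]]] := meet j1 j2 isT isT isT.
have star j : o != j -> exists2 pj, v != pj & E j =1 chi v pj.
  move=> oj; have [<-|j1j] := eqVneq j1 j; first by exists x.
  have [<-|j2j] := eqVneq j2 j; first by exists y.
  have [v1 [x1 [z1 [E1 E1' vx1 vz1 xz1]]]] := meet j1 j isT oj j1j.
  have [v2 [x2 [z2 [E2 E2' vx2 vz2 xz2]]]] := meet j2 j isT oj j2j.
  have chiT a b c d : chi a b =1 chi c d -> a != b -> a = c \/ a = d.
    by move=> /(_ a); rewrite /chi eqxx => ad /negPf ab; move: ad; rewrite ab addbF;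
       case: (eqVneq a c) => [-> _|_ /esym/eqP ->]; [left|right].
  have v1xy : v1 = v \/ v1 = x by apply: (chiT v1 x1) => // t; rewrite -E1 Ej1.
  have v2xy : v2 = v \/ v2 = y by apply: (chiT v2 x2) => // t; rewrite -E2 Ej2.
  case: v1xy => e1; first by exists z1; rewrite -e1.
  case: v2xy => e2; first by exists z2; rewrite -e2.
  exfalso; apply: (triple j1 j2 j) => // t; rewrite Ej1 Ej2.
  have z1y : z1 = y.
    have := E2' y; rewrite E1' e1 e2 /chi eqxx eq_sym (negPf xy) /=.
    by rewrite -e2 (negPf vz2) => /eqP.
  by rewrite E1' e1 z1y /chi; do 3 case: (t == _).
have [p pP] : {p : 'I_n -> 'I_n & forall j I, #|I| = k -> sep o j I = sep v (p j) (phi I)}.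
  apply: (@choice _ _ (fun j pj => forall I, #|I| = k -> sep o j I = sep v pj (phi I))).
  move=> j; have [<-|oj] := eqVneq o j.
    by exists v => I _; rewrite /sep !addbb.
  have [pj _ Epj] := star j oj; exists pj => I Ik.
  by rewrite (eP j oj).2 // -!par_chi; apply: par_ext.
have injp : injective p.
  move=> i j pij; apply: sep_const_eq => I Ik.
  by rewrite (sep_trans i o j) [sep i o I]addbC -/(sep o i I) !pP // pij addbb.
exists p => // I Ik; have pI j := pP j I Ik.
have [c cE] : exists c : bool, forall j, (p j \in phi I) = (j \in I) (+) c.
  exists ((o \in I) (+) (v \in phi I)) => j; have := pI j; rewrite /sep.
  by do 4 case: (_ \in _).
have p_surj y' : exists j, y' = p j.
  by have [q _ pq] := injF_bij injp; exists (q y'); rewrite pq.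
case: c cE => cE; last first.
  apply/setP => y'; have [j ->] := p_surj y'.
  by rewrite cE addbF (mem_imset _ _ injp).
case: n_neq; have : phi I = ~: (p @: I)%SET.
  apply/setP => y'; have [j ->] := p_surj y'.
  by rewrite cE addbT inE (mem_imset _ _ injp).
move=> phiE; have := cardsC (p @: I)%SET; rewrite -phiE phik //.
by rewrite card_imset // Ik card_ord; lia.
Qed.

(** If c were outside {i, j}, some k-set would separate c from d but not i from j: for small k one
    that contains c and avoids i and j, for large k one that contains i and j and exactly one of c
    and d. Applied to a pair sent forth by f and back by its inverse, this shows that the pair
    returns to itself. *)
Lemma sep_sub i j c d : i != j -> c != d ->
  (forall I, #|I| = k -> sep i j I = false -> sep c d I = false) ->
  forall I, sep c d I = sep i j I.
Proof.
have aux x y : i != j -> x != i -> x != j -> x != y ->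
    exists I, [/\ #|I| = k, sep i j I = false & sep x y I].
  move=> ij xi xj xy.
  have get A B : [disjoint A & B] -> (#|A| <= k)%N -> (k + #|B| <= n)%N ->
     exists I, [/\ #|I| = k, {subset A <= I} & {in B, forall z, z \notin I}].
    move=> AB Ak kB; have [I [AI IB Ik]] := ex_kset AB Ak kB.
    exists I; split=> // z; first exact: (fintype.subsetP AI).
    by move=> zB; apply/negP => zI; move: (disjointFr IB zI); rewrite zB.
  have mi : i \in [set i; j]%SET by rewrite !inE eqxx.
  have mj : j \in [set i; j]%SET by rewrite !inE eqxx orbT.
  have mx : x \in [set x]%SET by rewrite inE.
  have my : y \in [set y]%SET by rewrite inE.
  have [yij|yij] := boolP (y \in [set i; j]%SET).
    have [k1|k2] := leqP k (n - 2).
      have [||| I [Ik xI ijI]] := @get [set x]%SET [set i; j]%SET.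
      - by rewrite disjoints1 !inE negb_or xi.
      - by rewrite cards1.
      - by rewrite cards2 ij; lia.
      exists I; rewrite /sep (xI x mx) (negPf (ijI i mi)) (negPf (ijI j mj)).
      by rewrite (negPf (ijI y yij)).
    have [||| I [Ik ijI xI]] := @get [set i; j]%SET [set x]%SET.
    - by rewrite disjoint_sym disjoints1 !inE negb_or xi.
    - by rewrite cards2 ij; lia.
    - by rewrite cards1; lia.
    by exists I; rewrite /sep (ijI i mi) (ijI j mj) (ijI y yij) (negPf (xI x mx)).
  have yU A z : z \in A -> z \in (y |: A)%SET by move=> zA; rewrite !inE zA orbT.
  have [k1|k2] := leqP k (n - 3).
    have [||| I [Ik xI ijI]] := @get [set x]%SET (y |: [set i; j])%SET.
    - by rewrite disjoints1 !inE !negb_or xi xy.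
    - by rewrite cards1.
    - by rewrite cardsU1 yij cards2 ij; lia.
    exists I; rewrite /sep (xI x mx) (negPf (ijI i (yU _ _ mi))).
    rewrite (negPf (ijI j (yU _ _ mj))) (negPf (ijI y _)) //.
    by rewrite !inE eqxx.
  have [||| I [Ik ijI yI]] := @get (x |: [set i; j])%SET [set y]%SET.
  - rewrite disjoint_sym disjoints1 !inE eq_sym (negPf xy) /=.
    by rewrite !inE in yij.
  - by rewrite cardsU1 cards2 ij !inE (negPf xi) (negPf xj) /=; move: max_ge5; lia.
  - by rewrite cards1; lia.
  exists I; rewrite /sep (negPf (yI y my)) (ijI i) ?inE ?eqxx ?orbT //.
  by rewrite (ijI j) ?inE ?eqxx ?orbT // (ijI x) ?inE ?eqxx.
move=> ij cd sub.
have no x y : x != y -> (forall I, sep c d I = sep x y I) -> (x == i) || (x == j).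
  move=> xy exy; apply: contraT; rewrite negb_or => /andP[xi xj].
  have [I [Ik sI xI]] := aux x y ij xi xj xy.
  by have := sub I Ik sI; rewrite exy xI.
have /orP[/eqP ci|/eqP cj] := no c d cd (fun=> erefl).
all: have := no d c; rewrite eq_sym => /(_ cd).
all: case/(_ (fun I => addbC _ _))/orP => /eqP dE I.
- by rewrite ci dE eqxx in cd.
- by rewrite ci dE.
- by rewrite cj dE /sep addbC.
- by rewrite cj dE eqxx in cd.
Qed.
End FixedSize.
End SubsetPermutation.

(** * The action on frames *)

Section FrameMaps.
Variables (F : fieldType) (V : vectType F) (Omega : {skew_symmetric V}).
Hypothesis symplO : is_psymplectic Omega.
Variable n : nat.
Hypothesis dimV : \dim {:V} = (2 * n)%N.
Implicit Types (U W X : {vspace V}) (S T Z : 'I_n -> {vspace V}).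
Implicit Types (I J K : {set 'I_n}) (i j : 'I_n).

Local Notation "U ^!" := (orthov Omega U) : vspace_scope.
Local Notation hline := (Hset Omega 1).

Lemma frame_comp S (q : 'I_n -> 'I_n) : injective q -> frame Omega S ->
  frame Omega (S \o q).
Proof.
move=> injq fS; split=> [i _|i j _ _ ij] /=; first exact: frame_hline.
by apply: frame_perp => //; apply: contraNneq ij => /injq ->.
Qed.

Lemma sumI_comp S (q : 'I_n -> 'I_n) I : injective q ->
  sumI (S \o q) I = sumI S (q @: I)%SET.
Proof. by move=> injq; rewrite /sumI big_imset //= => i j _ _ /injq. Qed.

Lemma ksums_comp k S (q : 'I_n -> 'I_n) : injective q -> ksums k (S \o q) = ksums k S.
Proof.
move=> injq; apply/seteqP; split=> _ [I Ik ->].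
  by exists (q @: I)%SET; rewrite ?card_imset // sumI_comp.
have [r qK rK] := injF_bij injq.
exists (r @: I)%SET; first by rewrite card_imset //; apply: can_inj rK.
by rewrite sumI_comp // -imset_comp (eq_imset _ rK) imset_id.
Qed.

Lemma hline_not_orthov S X : frame Omega S -> hline X ->
  exists i, ~~ (X <= (S i)^!)%VS.
Proof.
move=> fS hX; apply: contrapT => no.
have [x xX x0] := hline_neq0 hX; have [rad0 _ _] := symplO.
case/negP: x0; rewrite -memv0 -(eqP rad0) -(frame_full dimV fS).
apply: (subvP _ _ xX); rewrite orthov_sym; apply: sumI_orthov => i _.
by rewrite orthov_sym; apply: contrapT => /negP Xi; apply: no; exists i.
Qed.

(* If R separates all indices, a line Z_m cannot meet two different S_i, S_j. *)
Lemma separated_frame S Z (R : {set 'I_n} -> Prop) : frame Omega S -> frame Omega Z ->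
  (forall I, R I -> exists J, sumI S I = sumI Z J) ->
  (forall i j, i != j -> exists2 I, R I & sep i j I) ->
  exists2 q : 'I_n -> 'I_n, injective q & Z = S \o q.
Proof.
move=> fS fZ RZ Rsep.
have Zsub m : exists i, Z m = S i.
  have [i Zi] := hline_not_orthov fS (frame_hline m fZ).
  exists i; apply: hline_le_eq (frame_hline m fZ) (frame_hline i fS) _.
  apply: (frame_perp_others symplO dimV fS) => j ji; apply: contraT => Zj.
  have [I RI] := Rsep _ _ ji; have [J IJ] := RZ I RI.
  have [mJ|mJ] := boolP (m \in J).
    have ZI : (Z m <= sumI S I)%VS by rewrite IJ; apply: sumI_sub.
    by rewrite /sep !(frame_notperp symplO dimV fS ZI).
  have ZI : (Z m <= sumI S (~: I))%VS.
    rewrite -(frame_orthov symplO dimV I fS) IJ (frame_orthov symplO dimV J fZ).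
    by apply: sumI_sub; rewrite inE.
  have := frame_notperp symplO dimV fS ZI Zi.
  have := frame_notperp symplO dimV fS ZI Zj.
  by rewrite !inE /sep => /negPf -> /negPf ->.
have [q Zq] := choice Zsub; exists q; last exact/funext.
by move=> i j ij; apply: (frame_inj symplO dimV fZ); rewrite !Zq ij.
Qed.

(** If [I] misses i and j, the summands agree. If it contains both, its complement misses both, and
    the sums are orthogonal complements of equal spaces. *)
Lemma frame_off_pair S Z i j I : frame Omega S -> frame Omega Z ->
  {in ~: [set i; j]%SET, Z =1 S} -> sep i j I = false -> sumI Z I = sumI S I.
Proof.
move=> fS fZ ZS; rewrite /sep.
have out J : i \notin J -> j \notin J -> sumI Z J = sumI S J.
  move=> iJ jJ; apply: eq_sumI => m mJ; apply: ZS; rewrite !inE negb_or.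
  by apply/andP; split; [apply: contraNneq iJ | apply: contraNneq jJ] => <-.
have [iI|iI] := boolP (i \in I); last by rewrite addFb => /negbT; apply: out.
move/negbFE => jI; rewrite -[I]setCK -(frame_orthov symplO dimV _ fZ).
rewrite -(frame_orthov symplO dimV _ fS) out //.
  by rewrite inE iI.
by rewrite inE jI.
Qed.

(* S_i and S_j are replaced by another decomposition of S_i + S_j. *)
Lemma mix_frame S i j : frame Omega S -> i != j ->
  exists2 Z, frame Omega Z &
    (forall I, sep i j I = false -> sumI Z I = sumI S I) /\
    (forall I J, sep i j I -> sumI Z I <> sumI S J).
Proof.
move=> fS ij.
have [x1 [y1 [x1S y1S xy1]]] := hline_ex (frame_hline i fS).
have [x2 [y2 [x2S y2S xy2]]] := hline_ex (frame_hline j fS).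
have SiSj := perpP Omega (S i) (S j); have := frame_perp fS ij.
move/(SiSj.2) => perp_ij.
have x12 : Omega x1 x2 = 0 by apply: perp_ij.
have y12 : Omega x2 y1 = 0 by rewrite formC perp_ij ?oppr0.
(* A sheared copy of [S i]: it keeps [x1], while its second generator sticks out into [S j]. *)
pose X := (<[x1]> + <[y1 + x2]>)%VS.
have hX : hline X by apply: hline_pair => //; rewrite formDr x12 addr0.
pose I0 := (~: [set i; j])%SET.
have iI0 : i \notin I0 by rewrite !inE eqxx.
have memS x m : x \in S m -> m \in ~: I0 -> (<[x]> <= (sumI S I0)^!)%VS.
  move=> xS mI; rewrite (frame_orthov symplO dimV _ fS).
  by apply: subv_trans (sumI_sub S mI); rewrite -memvE.
have XI0 : (X <= (sumI S I0)^!)%VS.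
  rewrite subv_add (memS _ i) ?inE ?eqxx //= -memvE memvD // memvE.
    by apply: (memS _ i); rewrite // !inE eqxx.
  by apply: (memS _ j); rewrite // !inE eqxx orbT.
have fX := frame_on_updf (frame_frame_on I0 fS) iI0 hX XI0.
have [Z fZ ZS] := frame_extend symplO dimV fX.
have Zi : Z i = X by rewrite ZS ?updf_eq // !inE eqxx.
have ZI0 : {in I0, Z =1 S}.
  move=> m mI; rewrite ZS ?updf_neq //; last by rewrite in_setU1 mI orbT.
  by apply: contraTneq mI => ->.
exists Z => //; split=> [I|]; first exact: (frame_off_pair fS fZ ZI0).
have x2Zj : x2 \in Z j.
  have := @frame_perp_others _ _ _ symplO _ dimV Z j <[x2]>%VS fZ; rewrite -memvE; apply.
  move=> m mj; have [->|mi] := eqVneq m i.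
    rewrite Zi orthovD -!memvE !mem_orthov_line formDr y12 form_alt // addr0 eqxx andbT.
    by rewrite formC x12 oppr0.
  rewrite ZI0 ?inE ?negb_or ?mi //; apply: subv_trans (frame_perp fS _) => /=.
    by rewrite -memvE; exact: x2S.
  by rewrite eq_sym.
(* In case of equality [x1] forces i into [J], so [y1] and then [x2] lie in [sumI Z I]; but [x2] is
   in [Z j], which that sum meets only in 0. *)
have no I J : i \in I -> j \notin I -> sumI Z I <> sumI S J.
  move=> iI jI ZIJ.
  have x1I : x1 \in sumI Z I.
    by apply: (subvP (sumI_sub Z iI)); rewrite Zi mem_pairl.
  have yxI : y1 + x2 \in sumI Z I.
    by apply: (subvP (sumI_sub Z iI)); rewrite Zi mem_pairr.
  have iJ : i \in J.
    apply: (@frame_notperp _ _ _ symplO _ dimV S J i <[x1]>%VS fS).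
      by rewrite -memvE -ZIJ.
    by apply/subvPn; exists x1; rewrite ?memv_line //; apply/mem_orthovPn; exists y1.
  have y1I : y1 \in sumI Z I by rewrite ZIJ; apply: (subvP (sumI_sub S iJ)).
  have x2I : x2 \in sumI Z I.
    by rewrite -[x2](addKr y1) memvD // memvN.
  have : x2 \in (sumI Z I :&: sumI Z [set j]%SET)%VS by rewrite memv_cap x2I sumI1.
  rewrite (frame_cap symplO dimV _ _ fZ) (_ : I :&: [set j]%SET = finset.set0); last first.
    by apply/eqP; rewrite setI_eq0 disjoint_sym disjoints1.
  rewrite /sumI big_set0 memv0 => /eqP x20; case/eqP: xy2.
  by rewrite x20 linear0l.
move=> I J; rewrite /sep; have [iI|iI] := boolP (i \in I).
  by rewrite addTb; apply: no.
rewrite addFb => jI /(congr1 (orthov Omega)).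
rewrite !(frame_orthov symplO dimV) //; apply: no; by rewrite inE ?jI.
Qed.
End FrameMaps.

(** * The bijection between the lines of two frames induced by f *)

Section InducedFrames.
Variables (F : fieldType) (V : vectType F) (Omega : {skew_symmetric V}).
Hypothesis symplO : is_psymplectic Omega.
Variables n k : nat.
Hypothesis dimV : \dim {:V} = (2 * n)%N.
Hypotheses (k_gt0 : (0 < k)%N) (k_lt : (k < n)%N) (n_neq : n <> (2 * k)%N).
Hypothesis (max_ge5 : (5 <= maxn k (n - k))%N).
Implicit Types (U W X : {vspace V}) (S T Z : 'I_n -> {vspace V}).
Implicit Types (I J K : {set 'I_n}) (i j : 'I_n) (f g : {vspace V} -> {vspace V}).

Local Notation "U ^!" := (orthov Omega U) : vspace_scope.
Local Notation hline := (Hset Omega 1).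

Lemma ksums_Hset S U : frame Omega S -> ksums k S U -> Hset Omega k U.
Proof.
move=> fS [I Ik ->]; split; last exact: frame_nondeg.
by rewrite (frame_dim _ fS) Ik.
Qed.

(** Always used in both directions, as [base_map f g] and [base_map g f]; both functions are
    constrained on H_k only. *)
Definition base_map f g : Prop :=
  (forall U, Hset Omega k U -> g (f U) = U) /\
  (forall S, frame Omega S ->
     exists2 T : 'I_n -> {vspace V}, frame Omega T & (f @` ksums k S = ksums k T)%classic).

Lemma base_map_inv f g : base_map f g -> forall S T, frame Omega S ->
  (f @` ksums k S = ksums k T)%classic -> (g @` ksums k T = ksums k S)%classic.
Proof.
move=> [fK _] S T fS ST; rewrite -ST; apply/seteqP; split=> U.
  by case=> _ [W SW <-] <-; rewrite fK //; apply: ksums_Hset SW.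
by move=> SU; exists (f U); [exists U | rewrite fK //; apply: ksums_Hset SU].
Qed.

(** The sums that do not separate i and j are shared with the mixed frame [Z], so their images are
    shared by [T] and the image frame of [Z]. If these images separated all pairs, the two image
    frames would agree up to numbering, and [Z] and [S] would define the same base subset. *)
Lemma inseparable_transport f g S T (phi : {set 'I_n} -> {set 'I_n}) i j :
  base_map f g -> frame Omega S -> frame Omega T ->
  (f @` ksums k S = ksums k T)%classic ->
  (forall I, #|I| = k -> f (sumI S I) = sumI T (phi I)) -> i != j ->
  exists a b, a != b /\
    forall I, #|I| = k -> sep i j I = false -> sep a b (phi I) = false.
Proof.
move=> bf fS fT ST fphi ij; apply: contrapT => no.
have [Z fZ [ZS Z_neq]] := mix_frame symplO dimV fS ij.
have [T' fT' ZT'] := bf.2 Z fZ.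
pose R J := exists I, [/\ #|I| = k, sep i j I = false & J = phi I].
have RT' J : R J -> exists J', sumI T J = sumI T' J'.
  case=> I [Ik sI ->]; rewrite -fphi // -ZS //.
  have : ksums k T' (f (sumI Z I)) by rewrite -ZT'; exists (sumI Z I) => //; exists I.
  by case=> J' _ ->; exists J'.
have Rsep a b : a != b -> exists2 J, R J & sep a b J.
  move=> ab; apply: contrapT => noJ; apply: no; exists a, b; split=> // I Ik sI.
  by apply/negP => sJ; apply: noJ; exists (phi I) => //; exists I.
have [q injq T'q] := separated_frame symplO dimV fT fT' RT' Rsep.
have ZSeq : ksums k Z = ksums k S.
  rewrite -(base_map_inv bf fZ ZT') -(base_map_inv bf fS ST).
  by rewrite T'q ksums_comp.
have [||| I [iI jI Ik]] := @ex_kset n k [set i]%SET [set j]%SET.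
- by rewrite disjoints1 inE.
- by rewrite cards1.
- by rewrite cards1 addn1.
rewrite finset.sub1set in iI; rewrite disjoint_sym disjoints1 in jI.
have : ksums k S (sumI Z I) by rewrite -ZSeq; exists I.
by case=> J _; apply: Z_neq; rewrite /sep iI (negPf jI).
Qed.

(** The permutation found by [ksets_perm] is absorbed into the numbering of [T], so that f keeps
    index sets. *)
Definition frame_map f S T : Prop :=
  [/\ frame Omega S, frame Omega T &
      forall I, #|I| = k -> f (sumI S I) = sumI T I].

Lemma frame_map_ex f g S : base_map f g -> base_map g f -> frame Omega S ->
  exists T, frame_map f S T.
Proof.
move=> bf bg fS; have [T fT ST] := bf.2 S fS.
have TS := base_map_inv bf fS ST.
have [phi phiP] : {phi : {set 'I_n} -> {set 'I_n} &
    forall I, #|I| = k -> #|phi I| = k /\ f (sumI S I) = sumI T (phi I)}.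
  apply: (@choice _ _ (fun I J => #|I| = k -> #|J| = k /\ f (sumI S I) = sumI T J)).
  move=> I; have [Ik|Ik] := eqVneq #|I| k; last by exists I => /eqP; rewrite (negPf Ik).
  have : ksums k T (f (sumI S I)) by rewrite -ST; exists (sumI S I) => //; exists I.
  by case=> J; exists J.
have [psi psiP] : {psi : {set 'I_n} -> {set 'I_n} &
    forall J, #|J| = k -> #|psi J| = k /\ g (sumI T J) = sumI S (psi J)}.
  apply: (@choice _ _ (fun J I => #|J| = k -> #|I| = k /\ g (sumI T J) = sumI S I)).
  move=> J; have [Jk|Jk] := eqVneq #|J| k; last by exists J => /eqP; rewrite (negPf Jk).
  have : ksums k S (g (sumI T J)) by rewrite -TS; exists (sumI T J) => //; exists J.
  by case=> I; exists I.
have HS I : #|I| = k -> Hset Omega k (sumI S I).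
  by move=> Ik; apply: (ksums_Hset fS); exists I.
have HT I : #|I| = k -> Hset Omega k (sumI T I).
  by move=> Ik; apply: (ksums_Hset fT); exists I.
have phiK I : #|I| = k -> psi (phi I) = I.
  move=> Ik; have [Jk fJ] := phiP I Ik; apply: (frame_sumI_inj symplO dimV fS).
  by rewrite -(psiP _ Jk).2 -fJ bf.1 //; apply: HS.
have psiK J : #|J| = k -> phi (psi J) = J.
  move=> Jk; have [Ik gI] := psiP J Jk; apply: (frame_sumI_inj symplO dimV fT).
  by rewrite -(phiP _ Ik).2 -gI bg.1 //; apply: HT.
have [|||i j ij|p injp phip] := @ksets_perm n k k_gt0 k_lt max_ge5 phi psi n_neq.
- by move=> I /phiP[].
- by move=> I /psiP[].
- exact: psiK.
- have [a [b [ab abP]]] := inseparable_transport bf fS fT ST (fun I Ik => (phiP I Ik).2) ij.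
  have [c [d [cd cdP]]] := inseparable_transport bg fT fS TS (fun I Ik => (psiP I Ik).2) ab.
  exists a, b; split=> // I Ik.
  (* The pair {i, j} was sent to {a, b} by f and on to {c, d} by g. As {c, d} separates the same
     sets as {i, j}, the two one-sided implications combine into the equivalence that [ksets_perm]
     requires. *)
  have cd_ij := sep_sub k_gt0 k_lt max_ge5 ij cd.
  have {}cd_ij : forall I', sep c d I' = sep i j I'.
    apply: cd_ij => I' Ik' sI; rewrite -(phiK I' Ik').
    by apply: cdP; [case: (phiP I' Ik') | apply: abP].
  case sI : (sep i j I); last by rewrite abP.
  apply/esym; apply: contraTT sI => /negbTE sJ.
  by rewrite -cd_ij -(phiK I Ik) cdP //; case: (phiP I Ik).
exists (T \o p); split=> //; first exact: frame_comp.
by move=> I Ik; rewrite sumI_comp // -phip // (phiP I Ik).2.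
Qed.
End InducedFrames.

(** * The induced map on hyperbolic lines *)

Section LineMap.
Variables (F : fieldType) (V : vectType F) (Omega : {skew_symmetric V}).
Hypothesis symplO : is_psymplectic Omega.
Variables n k : nat.
Hypothesis dimV : \dim {:V} = (2 * n)%N.
Hypotheses (k_gt0 : (0 < k)%N) (k_lt : (k < n)%N) (n_neq : n <> (2 * k)%N).
Hypothesis (max_ge5 : (5 <= maxn k (n - k))%N).
Variables (f g : {vspace V} -> {vspace V}).
Hypotheses (bf : base_map Omega n k f g) (bg : base_map Omega n k g f).
Implicit Types (X Y Z M N : {vspace V}) (S T U : 'I_n -> {vspace V}).
Implicit Types (I J K : {set 'I_n}) (i a b c : 'I_n) (j : nat).

Local Notation "U ^!" := (orthov Omega U) : vspace_scope.
Local Notation hline := (Hset Omega 1).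
Local Notation fmap := (frame_map Omega k f).

(** A relation instead of a function, since [M] might still depend on the frame; the descent proves
    that it does not. *)
Definition assigned j N M : Prop :=
  exists S T I, [/\ fmap S T, #|I| = j, N = sumI S I & M = sumI T I].

Definition assigned_uniq j : Prop :=
  forall N M M', assigned j N M -> assigned j N M' -> M = M'.

Lemma assigned_uniq_k : assigned_uniq k.
Proof.
move=> N M M' [S [T [I [[_ _ fST] Ik -> ->]]]] [S' [T' [I' [[_ _ fST'] Ik' eN ->]]]].
by rewrite -fST // -fST' // eN.
Qed.

(** Orthogonal complements turn sums of n - k lines into sums of k lines, where f itself gives the
    image. *)
Lemma assigned_uniq_co : assigned_uniq (n - k).
Proof.
move=> N M M' [S [T [I [[fS fT fST] Ik -> ->]]]].
case=> [S' [T' [I' [[fS' fT' fST'] Ik' eN ->]]]].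
have co J : #|J| = (n - k)%N -> #|~: J| = k.
  by move=> Jk; have := cardsC J; rewrite card_ord Jk; lia.
rewrite -[I]setCK -[I']setCK.
rewrite -(frame_orthov symplO dimV _ fT) -(frame_orthov symplO dimV _ fT').
rewrite -fST ?co // -fST' ?co //; congr (orthov _ (f _)).
by rewrite -(frame_orthov symplO dimV _ fS) eN (frame_orthov symplO dimV _ fS').
Qed.

Section Descent.
Variables (j : nat) (N : {vspace V}).
Hypotheses (j_bound : (j + 5 <= n)%N) (uniqS : assigned_uniq j.+1).

(* M is the image of N read off from those of N + X and N + Y; it will turn out
   not to depend on X and Y, because orthogonality of lines is connected. *)
Definition flagged X Y M : Prop :=
  exists S T I, exists a b, [/\ fmap S T, #|I| = j /\ [/\ a \notin I, b \notin I & a != b],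
    [/\ N = sumI S I, X = S a & Y = S b] & M = sumI T I].

Lemma flagged_sym X Y M : flagged X Y M -> flagged Y X M.
Proof.
case=> S [T [I [a [b [ST [Ij [aI bI ab]] [NS XS YS] MT]]]]].
by exists S, T, I, b, a; split=> //; split=> //; split=> //; rewrite eq_sym.
Qed.

Lemma flagged_perp X Y M : flagged X Y M ->
  [/\ hline X, hline Y & [/\ X <= Y^!, X <= N^! & Y <= N^!]%VS].
Proof.
case=> S [T [I [a [b [[fS _ _] [Ij [aI bI ab]] [-> -> ->] _]]]]].
have out c : c \notin I -> (S c <= (sumI S I)^!)%VS.
  by move=> cI; rewrite (frame_orthov symplO dimV _ fS) sumI_sub // inE.
split; rewrite ?out //; try exact: frame_hline.
by split; rewrite ?out //; apply: frame_perp fS ab.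
Qed.

Lemma cap_setU1 T I a b : frame Omega T -> a \notin I -> b \notin I -> a != b ->
  sumI T I = (sumI T (a |: I)%SET :&: sumI T (b |: I)%SET)%VS.
Proof.
move=> fT aI bI ab; rewrite (frame_cap symplO dimV _ _ fT); congr sumI.
apply/setP => c; rewrite !inE; have [->|ca] := eqVneq c a.
  by rewrite (negPf ab) (negPf aI).
by rewrite andb_orl /= orbC; case: (c \in I); rewrite ?andbF.
Qed.

Lemma flagged_uniq X Y M M' : flagged X Y M -> flagged X Y M' -> M = M'.
Proof.
case=> S [T [I [a [b [ST [Ij [aI bI ab]] [NS XS YS] ->]]]]].
case=> S' [T' [I' [a' [b' [ST' [Ij' [aI' bI' ab']] [NS' XS' YS'] ->]]]]].
have [fS fT _] := ST; have [fS' fT' _] := ST'.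
rewrite (cap_setU1 fT aI bI ab) (cap_setU1 fT' aI' bI' ab'); congr (_ :&: _)%VS.
  apply: (uniqS (N := (X + N)%VS)).
    by exists S, T, (a |: I)%SET; rewrite cardsU1 aI Ij sumI_setU1 XS NS.
  by exists S', T', (a' |: I')%SET; rewrite cardsU1 aI' Ij' sumI_setU1 XS' NS'.
apply: (uniqS (N := (Y + N)%VS)).
  by exists S, T, (b |: I)%SET; rewrite cardsU1 bI Ij sumI_setU1 YS NS.
by exists S', T', (b' |: I')%SET; rewrite cardsU1 bI' Ij' sumI_setU1 YS' NS'.
Qed.

(** Some frame contains X, Y, Z and the lines of N. By [uniqS] it gives N + X and N + Y the same
    images as the old frame, hence the same intersection [M]. *)
Lemma flagged_swap X Y Z M : flagged X Y M -> hline Z ->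
  (Z <= X^!)%VS -> (Z <= Y^!)%VS -> (Z <= N^!)%VS -> flagged X Z M.
Proof.
case=> S [T [I [a [b [ST [Ij [aI bI ab]] [NS XS YS] MT]]]]] hZ ZX ZY ZN.
have [fS fT _] := ST; pose K := (a |: (b |: I))%SET.
have cardK : #|K| = j.+2 by rewrite /K !cardsU1 !inE negb_or ab aI bI Ij.
have [|c cK] := @ex_notin n K; first by rewrite cardK; lia.
have ZK : (Z <= (sumI S K)^!)%VS.
  by rewrite /K !sumI_setU1 !orthovD -XS -YS -NS ZX ZY.
have fU := frame_on_updf (frame_frame_on K fS) cK hZ ZK.
have [U {}fU US] := frame_extend symplO dimV fU.
have Uc : U c = Z by rewrite US ?updf_eq // !inE eqxx.
have UK : {in K, U =1 S}.
  move=> i iK; rewrite US ?updf_neq //; last by rewrite in_setU1 iK orbT.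
  by apply: contraNneq cK => <-.
have [T' UT'] := frame_map_ex symplO dimV k_gt0 k_lt n_neq max_ge5 bf bg fU.
have [_ fT' _] := UT'.
have USI J : J \subset K -> sumI U J = sumI S J.
  by move/fintype.subsetP => JK; apply: eq_sumI => i /JK; apply: UK.
have aK : (a |: I)%SET \subset K.
  by apply/fintype.subsetP => i; rewrite !inE => /orP[] ->; rewrite ?orbT.
have bK : (b |: I)%SET \subset K.
  by apply/fintype.subsetP => i; rewrite !inE => /orP[] ->; rewrite ?orbT.
have IK : I \subset K by apply/fintype.subsetP => i; rewrite !inE => ->; rewrite !orbT.
have T'T d : (d |: I)%SET \subset K -> d \notin I -> sumI T' (d |: I) = sumI T (d |: I).
  move=> dK dI; apply: (uniqS (N := sumI S (d |: I)%SET)).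
    by exists U, T', (d |: I)%SET; rewrite cardsU1 dI Ij USI.
  by exists S, T, (d |: I)%SET; rewrite cardsU1 dI Ij.
exists U, T', I, a, c; split=> //; last first.
- by rewrite MT (cap_setU1 fT aI bI ab) (cap_setU1 fT' aI bI ab) !T'T.
- by rewrite USI // UK // !inE eqxx.
split=> //; split=> //.
  by apply: contraNN cK; apply: (fintype.subsetP IK).
by apply: contraNneq cK => <-; rewrite !inE eqxx.
Qed.

(** [j_bound] is spent here: the orthogonal complement of N + X + Y has rank n - j - 2 >= 3, enough
    for a line that is also orthogonal to an arbitrary [Z]. *)
Lemma flagged_ex X Y M Z : flagged X Y M -> hline Z ->
  exists2 W, hline W & [/\ W <= N^!, W <= X^!, W <= Y^! & W <= Z^!]%VS.
Proof.
case=> S [T [I [a [b [[fS _ _] [Ij [aI bI ab]] [NS XS YS] MT]]]]] [dZ _].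
have := @ex_hline_orthov _ _ _ symplO (sumI S (a |: (b |: I))%SET) Z.
rewrite (frame_dim _ fS) !cardsU1 !inE negb_or ab aI bI Ij dimV dZ.
case=> [|||W hW]; [exact: frame_nondeg|lia|by []|].
rewrite subv_cap !sumI_setU1 !orthovD -XS -YS -NS => /andP[/and3P[WX WY WN] WZ].
by exists W.
Qed.

(** Lines are exchanged one at a time, through the pairs (A, B), (A, C), (C, D), (C, A'), (A', E),
    (A', B'). Choosing C and D orthogonal to A', and E orthogonal to B', makes the entry of A' and
    B' possible. *)
Lemma flagged_connected A B A' B' M M' :
  flagged A B M -> flagged A' B' M' -> M = M'.
Proof.
move=> AB AB'; have [hA' hB' [A'B' A'N B'N]] := flagged_perp AB'.
have [C hC [CN CA CB CA']] := flagged_ex AB hA'.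
have /flagged_sym CAM := flagged_swap AB hC CA CB CN.
have [D hD [DN DC DA DA']] := flagged_ex CAM hA'.
have CDM := flagged_swap CAM hD DC DA DN.
have A'C : (A' <= C^!)%VS by rewrite orthov_sym.
have A'D : (A' <= D^!)%VS by rewrite orthov_sym.
have /flagged_sym A'CM := flagged_swap CDM hA' A'C A'D A'N.
have [E hE [EN EA' EC EB']] := flagged_ex A'CM hB'.
have A'EM := flagged_swap A'CM hE EA' EC EN.
have B'A' : (B' <= A'^!)%VS by rewrite orthov_sym.
have B'E : (B' <= E^!)%VS by rewrite orthov_sym.
exact: flagged_uniq (flagged_swap A'EM hB' B'A' B'E B'N) AB'.
Qed.

Lemma assigned_flagged M : assigned j N M -> exists X Y, flagged X Y M.
Proof.
case=> S [T [I [ST Ij NS MT]]].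
have [|a aI] := @ex_notin n I; first by rewrite Ij; lia.
have [|b] := @ex_notin n (a |: I)%SET; first by rewrite cardsU1 aI Ij; lia.
rewrite !inE negb_or => /andP[ba bI].
by exists (S a), (S b), S, T, I, a, b; split=> //; split=> //; split=> //; rewrite eq_sym.
Qed.

End Descent.

Lemma assigned_uniq_pred j : (j + 5 <= n)%N -> assigned_uniq j.+1 -> assigned_uniq j.
Proof.
move=> jn uj N M M' /(assigned_flagged jn)[X [Y XY]] /(assigned_flagged jn)[X' [Y' XY']].
exact: flagged_connected jn uj _ _ _ _ _ _ XY XY'.
Qed.

(** A descent from m needs m + 4 <= n. It starts at k, or else at n - k: if n - k <= 3, then
    [max_ge5] forces k >= 5. *)
Lemma assigned_uniq1 : assigned_uniq 1.
Proof.
have down m : (m + 4 <= n)%N -> assigned_uniq m -> forall d, (d < m)%N -> assigned_uniq (m - d).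
  move=> mn um; elim=> [|d IHd] dm; first by rewrite subn0.
  apply: assigned_uniq_pred; first lia.
  by rewrite (_ : (m - d.+1).+1 = (m - d)%N); [apply: IHd|]; lia.
have [kn|nk] := leqP (k + 4) n.
  by have := down k kn assigned_uniq_k k.-1; rewrite (_ : (k - k.-1)%N = 1%N); [apply; lia|lia].
have nkn : (n - k + 4 <= n)%N by move: max_ge5; lia.
have := down _ nkn assigned_uniq_co (n - k).-1.
by rewrite (_ : (n - k - (n - k).-1)%N = 1%N); [apply; lia|lia].
Qed.

End LineMap.

(** * The bijection of hyperbolic lines that preserves orthogonality *)

Section LineBijection.
Variables (F : fieldType) (V : vectType F) (Omega : {skew_symmetric V}).
Hypothesis symplO : is_psymplectic Omega.
Variables n k : nat.
Hypothesis dimV : \dim {:V} = (2 * n)%N.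
Implicit Types (X Y Z M N U W : {vspace V}) (S T : 'I_n -> {vspace V}).
Implicit Types (I J K : {set 'I_n}) (i a b c : 'I_n) (j : nat).
Implicit Types (f g : {vspace V} -> {vspace V}).

Local Notation "U ^!" := (orthov Omega U) : vspace_scope.
Local Notation hline := (Hset Omega 1).

(** Lines are split off [U] one by one. The part [W] of [U] orthogonal to the lines already found
    cannot be totally isotropic, as it would then lie in the radical of [U]. *)
Lemma Hset_frame U : Hset Omega k U ->
  exists2 S : 'I_n -> {vspace V}, frame Omega S &
    exists2 I : {set 'I_n}, #|I| = k & U = sumI S I.
Proof.
move=> [dU ndU].
suff [S [I [fS Ik SU]]] : exists (S : 'I_n -> {vspace V}) (I : {set 'I_n}),
    [/\ frame_on Omega I S, #|I| = k & (sumI S I <= U)%VS].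
  have [T fT TS] := frame_extend symplO dimV fS.
  exists T => //; exists I => //; apply/esym/eqP; rewrite eqEdim (eq_sumI TS) SU /=.
  by have [_ ->] := frame_on_sum fS; rewrite dU Ik.
have kn : (k <= n)%N by have := dimvS (subvf U); rewrite dU dimV; lia.
have : (k <= k)%N by [].
elim: {1 3}k => [_|j IHj jk].
  exists (fun=> 0%VS), finset.set0; split; rewrite ?cards0 //; last first.
    by rewrite /sumI big_set0 sub0v.
  by split=> [i|i i']; rewrite inE.
have [S [I [fS Ij SU]]] := IHj (ltnW jk).
have [ndI dI] := frame_on_sum fS.
pose W := ((sumI S I)^! :&: U)%VS.
have sumW : (sumI S I + W = U)%VS.
  rewrite vspace_modl // (_ : (sumI S I + (sumI S I)^!)%VS = fullv) ?capfv //.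
  apply/eqP; rewrite eqEdim subvf dimv_disjoint_sum; last exact: nondegenerate_on_cap0.
  by rewrite /= addnC (dim_orthov symplO).
have [|X hX XW] := @not_isotropic_hline _ _ _ symplO W.
  apply/negP => isoW; suff : \dim W = 0%N.
    have := dimv_add_leqif (sumI S I) W; rewrite sumW dU dI Ij => -[+ _]; lia.
  apply/eqP; rewrite dimv_eq0 -subv0 -(nondegenerate_on_cap0 ndU) subv_cap capvSr /=.
  by rewrite -sumW orthovD isoW andbT capvSl.
have [|c cI] := @ex_notin n I; first by rewrite Ij; lia.
exists (updf S c X), (c |: I)%SET; split.
- by apply: frame_on_updf => //; apply: subv_trans XW (capvSl _ _).
- by rewrite cardsU1 cI Ij.
- rewrite sumI_setU1 updf_eq updf_sumI // subv_add SU andbT.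
  exact: subv_trans XW (capvSr _ _).
Qed.

Hypotheses (k_gt0 : (0 < k)%N) (k_lt : (k < n)%N) (n_neq : n <> (2 * k)%N).
Hypothesis (max_ge5 : (5 <= maxn k (n - k))%N).


Lemma perp_hlines_frame X Y : hline X -> hline Y -> (X <= Y^!)%VS ->
  exists2 S : 'I_n -> {vspace V}, frame Omega S & exists a b, [/\ a != b, S a = X & S b = Y].
Proof.
move=> hX hY XY.
have n1 : (1 < n)%N by lia. have n0 : (0 < n)%N by lia.
pose a : 'I_n := Ordinal n0; pose b : 'I_n := Ordinal n1.
pose S := updf (fun=> Y) a X.
have : frame_on Omega (a |: [set b])%SET S.
  apply: frame_on_updf; rewrite ?inE //; last by rewrite /sumI big_set1.
  split=> [i|i i']; rewrite !inE //.
  by move=> /eqP -> /eqP ->; rewrite eqxx.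
move=> fS; have [T fT TS] := frame_extend symplO dimV fS.
exists T => //; exists a, b; split=> //.
  by rewrite TS ?inE ?eqxx // /S updf_eq.
by rewrite TS ?inE ?eqxx ?orbT // /S updf_neq.
Qed.

Lemma hline_frame X : hline X ->
  exists2 S : 'I_n -> {vspace V}, frame Omega S & exists a, S a = X.
Proof.
move=> hX; have [_ ndX] := hX; have [dX _] := hX.
have [|Y hY YX] := nondegenerate_hline symplO (nondegenerate_on_orthov symplO ndX).
  rewrite -dimv_eq0; have := dim_orthov symplO X; rewrite dX dimV.
  by move: (\dim _) => d; rewrite -lt0n; lia.
rewrite orthov_sym in YX.
by have [S fS [a [b [_ Sa _]]]] := perp_hlines_frame hX hY YX; exists S => //; exists a.
Qed.

Lemma frame_map_inv f g S T : base_map Omega n k f g ->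
  frame_map Omega k f S T -> frame_map Omega k g T S.
Proof.
move=> bf [fS fT fST]; split=> // I Ik; rewrite -fST // bf.1 //.
by apply: (ksums_Hset fS); exists I.
Qed.

Lemma assigned_inv f g X Y j : base_map Omega n k f g ->
  assigned Omega n k f j X Y -> assigned Omega n k g j Y X.
Proof.
move=> bf [S [T [I [ST Ij NS MT]]]].
by exists T, S, I; split=> //; apply: frame_map_inv ST.
Qed.

Lemma line_map_ex f g : base_map Omega n k f g -> base_map Omega n k g f ->
  exists G, [/\ forall X, hline X -> assigned Omega n k f 1 X (G X),
    forall X, hline X -> hline (G X),
    forall S T, frame_map Omega k f S T -> T = G \o S &
    forall X Y, hline X -> hline Y -> (X <= Y^!)%VS -> (G X <= (G Y)^!)%VS].
Proof.
move=> bf bg; have uniq1 := assigned_uniq1 symplO dimV k_gt0 k_lt n_neq max_ge5 bf bg.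
have [G GP] : {G : {vspace V} -> {vspace V} &
    forall X, hline X -> assigned Omega n k f 1 X (G X)}.
  apply: (@choice _ _ (fun X M => hline X -> assigned Omega n k f 1 X M)) => X.
  have [hX|nX] := pselect (hline X); last by exists 0%VS.
  have [S fS [a Sa]] := hline_frame hX.
  have [T ST] := frame_map_ex symplO dimV k_gt0 k_lt n_neq max_ge5 bf bg fS.
  exists (T a) => _; exists S, T, [set a]%SET.
  by rewrite cards1 !sumI1.
have GS S T : frame_map Omega k f S T -> T = G \o S.
  move=> ST; have [fS fT _] := ST; apply/funext => a /=.
  apply: (uniq1 (S a)); last by apply: GP; apply: frame_hline.
  by exists S, T, [set a]%SET; rewrite cards1 !sumI1.
exists G; split=> //.
  move=> X /GP[S [T [I [[fS fT _] I1 _ ->]]]].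
  have /cards1P[a ->] : #|I| == 1%N by rewrite I1.
  by rewrite sumI1; apply: frame_hline.
move=> X Y hX hY XY; have [S fS [a [b [ab <- <-]]]] := perp_hlines_frame hX hY XY.
have [T ST] := frame_map_ex symplO dimV k_gt0 k_lt n_neq max_ge5 bf bg fS.
have [_ fT _] := ST; have := frame_perp fT ab.
by rewrite (GS _ _ ST).
Qed.

(** The last clause ties f back to G: a map that induces G on lines and respects sums will induce
    f. *)
Lemma line_bijection f g : base_map Omega n k f g -> base_map Omega n k g f ->
  exists G G', [/\ forall X, hline X -> hline (G X) /\ G' (G X) = X,
    forall X, hline X -> hline (G' X) /\ G (G' X) = X,
    forall X Y, hline X -> hline Y -> (X <= Y^!)%VS = (G X <= (G Y)^!)%VS &
    forall U, Hset Omega k U -> exists (S : 'I_n -> {vspace V}) (I : {set 'I_n}),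
      [/\ frame Omega S, U = sumI S I & f U = sumI (G \o S) I]].
Proof.
move=> bf bg.
have [G [GP hG GS perpG]] := line_map_ex bf bg.
have [G' [GP' hG' GS' perpG']] := line_map_ex bg bf.
have uniqf := assigned_uniq1 symplO dimV k_gt0 k_lt n_neq max_ge5 bf bg.
have uniqg := assigned_uniq1 symplO dimV k_gt0 k_lt n_neq max_ge5 bg bf.
have GK X : hline X -> G' (G X) = X.
  by move=> hX; apply: (uniqg (G X)); [apply/GP'/hG | apply/(assigned_inv bf)/GP].
have GK' X : hline X -> G (G' X) = X.
  by move=> hX; apply: (uniqf (G' X)); [apply/GP/hG' | apply/(assigned_inv bg)/GP'].
exists G, G'; split=> [X hX|X hX|X Y hX hY|U hU].
- by split; [apply: hG | apply: GK].
- by split; [apply: hG' | apply: GK'].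
- apply/idP/idP; first exact: perpG.
  by move/(perpG' _ _ (hG _ hX) (hG _ hY)); rewrite !GK.
have [S fS [I Ik US]] := Hset_frame hU.
have [T ST] := frame_map_ex symplO dimV k_gt0 k_lt n_neq max_ge5 bf bg fS.
exists S, I; split=> //; rewrite -(GS _ _ ST) US.
by case: ST => _ _; apply.
Qed.
End LineBijection.

(** * From hyperbolic lines to points *)

Section PointMap.
Variables (F : fieldType) (V : vectType F) (Omega : {skew_symmetric V}).
Hypothesis symplO : is_psymplectic Omega.
Hypothesis dimV : (10 <= \dim {:V})%N.
Implicit Types (A B C S T X Y Z : {vspace V}) (x y z : V).
Implicit Types (G : {vspace V} -> {vspace V}).

Local Notation "U ^!" := (orthov Omega U) : vspace_scope.
Local Notation hline := (Hset Omega 1).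

Lemma dimv_addL A B : (\dim (A + B) <= \dim A + \dim B)%N.
Proof. by have [] := dimv_add_leqif A B. Qed.

(** The hyperbolic lines inside (S + T)^! span it: by dimension it contains u and v with Omega(u, v)
    nonzero, and for any y in it, y or v + y is not orthogonal to u. So orthogonality to these lines
    means membership in the double complement S + T. *)
Lemma hline_le_addP S T Z : hline S -> hline T ->
  (Z <= S + T)%VS <->
  (forall Y, hline Y -> (Y <= S^!)%VS -> (Y <= T^!)%VS -> (Y <= Z^!)%VS).
Proof.
move=> [dS _] [dT _]; split=> [ZST Y _ YS YT|orthZ].
  by rewrite orthov_sym (subv_trans ZST) // subv_add !(orthov_sym Omega _ Y) YS YT.
have hX u v : u \in ((S + T)^!)%VS -> v \in ((S + T)^!)%VS -> Omega u v != 0 ->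
    u \in (Z^!)%VS /\ v \in (Z^!)%VS.
  move=> uX vX uv; have : (<[u]> + <[v]> <= Z^!)%VS.
    have : (<[u]> + <[v]> <= (S + T)^!)%VS by rewrite subv_add -!memvE uX.
    by rewrite orthovD => /andP[]; apply: orthZ (hline_pair _ uv).
  by rewrite subv_add -!memvE => /andP[].
have [|D hD DX] := @not_isotropic_hline _ _ _ symplO ((S + T)^!)%VS.
  apply/negP; rewrite orthovK // => /dimvS; have := dim_orthov symplO (S + T)%VS.
  by have := dimv_addL S T; rewrite dS dT; lia.
have [u [v [uD vD uv]]] := hline_ex hD.
have uX := subvP DX _ uD; have vX := subvP DX _ vD.
have [uZ vZ] := hX u v uX vX uv.
rewrite -[Z](orthovK symplO) -[(S + T)%VS](orthovK symplO); apply: orthovS.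
apply/subvP => y yX; have [uy|uy] := eqVneq (Omega u y) 0; last by have [] := hX u y uX yX uy.
have [] := hX u (v + y) uX (memvD vX yX); first by rewrite formDr uy addr0.
by move=> _ vyZ; rewrite -[y](addKr v) memvD // memvN.
Qed.

Definition line_iso G G' : Prop :=
  [/\ forall X, hline X -> hline (G X) /\ G' (G X) = X,
      forall X, hline X -> hline (G' X) /\ G (G' X) = X &
      forall X Y, hline X -> hline Y -> (X <= Y^!)%VS = (G X <= (G Y)^!)%VS].

Lemma line_iso_sym G G' : line_iso G G' -> line_iso G' G.
Proof.
move=> [GH GH' GP]; split=> // X Y hX hY.
have [hGX GX] := GH' X hX; have [hGY GY] := GH' Y hY.
by rewrite (GP (G' X)) // GX GY.
Qed.

Lemma line_iso_inj G G' S T : line_iso G G' -> hline S -> hline T ->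
  (G S == G T) = (S == T).
Proof.
move=> [GH _ _] hS hT; apply/eqP/eqP=> [|-> //].
by move/(congr1 G'); rewrite (GH S hS).2 (GH T hT).2.
Qed.

Lemma line_iso_le_add_aux G G' S T Z : line_iso G G' -> hline S -> hline T -> hline Z ->
  (Z <= S + T)%VS -> (G Z <= G S + G T)%VS.
Proof.
move=> [GH GH' GP] hS hT hZ /(hline_le_addP Z hS hT) ZST.
apply/(hline_le_addP _ (GH S hS).1 (GH T hT).1) => Y hY.
have [hY' <-] := GH' Y hY.
by rewrite -!GP //; apply: ZST.
Qed.

Lemma line_iso_le_add G G' S T Z : line_iso G G' -> hline S -> hline T -> hline Z ->
  (G Z <= G S + G T)%VS = (Z <= S + T)%VS.
Proof.
move=> GG hS hT hZ; have [GH _ _] := GG; apply/idP/idP; last exact: line_iso_le_add_aux GG _ _ _.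
move/(line_iso_le_add_aux (line_iso_sym GG) (GH S hS).1 (GH T hT).1 (GH Z hZ).1).
by rewrite !(GH _ _).2.
Qed.

Lemma hline_neq_dim S T : hline S -> hline T -> S != T -> (3 <= \dim (S + T))%N.
Proof.
move=> hS hT; apply: contraNT; rewrite -leqNgt => le2.
have [dS _] := hS; have [dT _] := hT.
have eS : S = (S + T)%VS by apply/eqP; rewrite eqEdim addvSl dS.
have eT : T = (S + T)%VS by apply/eqP; rewrite eqEdim addvSr dT.
by rewrite eS {2}eT.
Qed.

Lemma hline_meet_dim S T x : hline S -> hline T -> x \in S -> x \in T -> x != 0 ->
  (\dim (S + T) <= 3)%N.
Proof.
move=> [dS _] [dT _] xS xT x0; have := dimv_sum_cap S T; rewrite dS dT.
have : (\dim <[x]> <= \dim (S :&: T))%N by apply: dimvS; rewrite subv_cap -!memvE xS.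
by rewrite dim_vline x0; lia.
Qed.

Lemma hline_cap S T x : hline S -> hline T -> S != T -> x \in S -> x \in T -> x != 0 ->
  (S :&: T = <[x]>)%VS.
Proof.
move=> hS hT ST xS xT x0; apply/esym/eqP; rewrite eqEdim subv_cap -!memvE xS xT /=.
have := dimv_sum_cap S T; have := hline_neq_dim hS hT ST.
by rewrite dim_vline x0; case: hS => -> _; case: hT => -> _; lia.
Qed.

(* Two lines meet iff their span is 3-dimensional, i.e. iff it is spanned by any
   two different hyperbolic lines in it. *)
Lemma hline_meetP S T : hline S -> hline T ->
  (S :&: T)%VS != 0%VS <->
  (forall A B, hline A -> hline B -> (A <= S + T)%VS -> (B <= S + T)%VS -> A != B ->
    (S <= A + B)%VS /\ (T <= A + B)%VS).
Proof.
move=> hS hT; split=> [meet A B hA hB AST BST AB|closed].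
  have [x /memv_capP[xS xT] x0] : exists2 x, x \in (S :&: T)%VS & x != 0.
    by exists (vpick (S :&: T)%VS); rewrite ?memv_pick // vpick0.
  have : (A + B == S + T)%VS.
    rewrite eqEdim subv_add AST BST /=.
    by apply: leq_trans (hline_meet_dim hS hT xS xT x0) (hline_neq_dim hA hB AB).
  by move/eqP ->; rewrite addvSl addvSr.
apply/eqP => cap0; have [dT _] := hT; have [dS _] := hS.
have [x [y [xS yS xy]]] := hline_ex hS.
(* For t in T orthogonal to x, the lines S = <x, y> and <x, y + t> span only S + <t>, too small to
   contain T when S and T are disjoint. *)
pose W := (T :&: <[x]>^!)%VS; pose t := vpick W.
have /memv_capP[tT tx] : t \in W by exact: memv_pick.
have t0 : t != 0.
  rewrite vpick0 -dimv_eq0; have := dim_cap_orthov Omega T <[x]>%VS.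
  by rewrite dT dim_vline (form_neq0_l xy) -/W; case: (\dim W).
have xt : Omega x t = 0 by apply/eqP; rewrite form_eq0C -mem_orthov_line.
have tS : t \notin S.
  apply: contraNN t0 => tS; rewrite -memv0 -cap0 memv_cap tS tT //.
have hB : hline (<[x]> + <[y + t]>)%VS by apply: hline_pair => //; rewrite formDr xt addr0.
have [||| ST TT] := closed S (<[x]> + <[y + t]>)%VS hS hB.
- exact: addvSl.
- by rewrite subv_add -!memvE memv_add // (subvP (addvSl _ _)).
- apply: contraNneq tS => SB; rewrite -[t](addKr y) memvD ?memvN //.
  by rewrite SB mem_pairr.
have : (S + T <= S + <[t]>)%VS.
  rewrite subv_add addvSl /=; apply: subv_trans TT _.
  rewrite subv_add addvSl /= subv_add -!memvE memv_add ?memv_line //.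
  by rewrite (subvP (addvSl _ _)).
move/dimvS; have := dimv_addL S <[t]>%VS; rewrite (dimv_disjoint_sum cap0).
by rewrite dS dT dim_vline t0; lia.
Qed.

Lemma line_iso_meet_aux G G' S T : line_iso G G' -> hline S -> hline T ->
  (S :&: T)%VS != 0%VS -> (G S :&: G T)%VS != 0%VS.
Proof.
move=> GG hS hT /(hline_meetP hS hT) closed; have [GH GH' _] := GG.
apply/(hline_meetP (GH S hS).1 (GH T hT).1) => A B hA hB.
have [hA' <-] := GH' A hA; have [hB' <-] := GH' B hB.
rewrite !(line_iso_le_add GG) // (line_iso_inj GG) //.
exact: closed.
Qed.

(** If C met A and B in different points, it would be spanned by them and lie in A + B. So it meets
    both in the same point, which is the point of x. *)
Lemma concurrent A B C x : hline A -> hline B -> hline C -> A != B ->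
  x \in A -> x \in B -> x != 0 -> ~~ (C <= A + B)%VS ->
  (C :&: A)%VS != 0%VS -> (C :&: B)%VS != 0%VS -> x \in C.
Proof.
move=> hA hB hC AB xA xB x0 CAB; rewrite -!vpick0.
set a := vpick _; set b := vpick _ => a0 b0.
have /memv_capP[aC aA] : a \in (C :&: A)%VS by exact: memv_pick.
have /memv_capP[bC bB] : b \in (C :&: B)%VS by exact: memv_pick.
have [/vlineP[c bca]|ab] := boolP (b \in <[a]>%VS).
  have c0 : c != 0 by apply: contraNneq b0 => c0; rewrite bca c0 scale0r.
  have : b \in (A :&: B)%VS by rewrite memv_cap bB andbT bca memvZ.
  rewrite (hline_cap hA hB AB xA xB x0) => /vlineP[d bdx].
  have d0 : d != 0 by apply: contraNneq b0 => d0; rewrite bdx d0 scale0r.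
  by rewrite -[x](scalerK d0) -bdx memvZ.
case/negP: CAB; have [dC _] := hC.
by rewrite (dimv2P dC aC bC ab a0) addvS // -memvE.
Qed.

Lemma hline_through x : x != 0 -> exists2 S, hline S & x \in S.
Proof.
move=> x0; have [rad0 _ _] := symplO.
have : x \notin (fullv^!)%VS by rewrite (eqP rad0) memv0.
by case/mem_orthovPn => y _ xy; exists (<[x]> + <[y]>)%VS; [exact: hline_pair | exact: mem_pairl].
Qed.

(** A partner y of x in S is moved by some w in S^! outside X; such w exists because S^! has
    dimension at least 8. *)
Lemma hline_through_avoiding S X x : hline S -> x \in S -> x != 0 ->
  (S <= X)%VS -> (\dim X < 8)%N -> exists2 T, hline T & x \in T /\ ~~ (T <= X)%VS.
Proof.
move=> hS xS x0 SX dX; have [y yS xy] := hline_partner hS xS x0.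
have [dS _] := hS.
have /subvPn[w wS wX] : ~~ (S^! <= X)%VS.
  by apply/negP => /dimvS; have := dim_orthov symplO S; rewrite dS; lia.
have xw : Omega x w = 0.
  by apply/eqP; rewrite form_eq0C; apply/eqP; exact: (mem_orthovP wS).
exists (<[x]> + <[y + w]>)%VS; first by apply: hline_pair; rewrite ?formDr ?xw ?addr0.
split; first exact: mem_pairl.
apply: contraNN wX => TX; rewrite -[w](addKr y) memvD ?memvN //.
  exact: (subvP SX).
exact: (subvP TX _ (mem_pairr _ _)).
Qed.

Lemma mem_line_hlines x y : x != 0 ->
  (forall S, hline S -> x \in S -> y \in S) -> y \in <[x]>%VS.
Proof.
move=> x0 xy; have [S hS xS] := hline_through x0.
have [|T hT [xT TS]] := hline_through_avoiding hS xS x0 (subvv S).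
  by case: hS => ->.
have ST : S != T by apply: contraNneq TS => ->.
by rewrite -(hline_cap hS hT ST xS xT x0) memv_cap !xy.
Qed.

(** The images of two lines [S1], [S2] through x meet in the candidate [x']. Lines off S1 + S2 pass
    through it by [concurrent]; a line inside S1 + S2 is compared with [S1] and a third line [S4]
    off that span. *)
Lemma pencil_image G G' x : line_iso G G' -> x != 0 ->
  exists2 x', x' != 0 & forall S, hline S -> x \in S -> x' \in G S.
Proof.
move=> GG x0; have [GH _ _] := GG.
have [S1 hS1 xS1] := hline_through x0; have [dS1 _] := hS1.
have [|S2 hS2 [xS2 S21]] := hline_through_avoiding hS1 xS1 x0 (subvv S1).
  by rewrite dS1.
have S12 : S1 != S2 by apply: contraNneq S21 => ->.
have [hG1 _] := GH _ hS1; have [hG2 _] := GH _ hS2.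
have meet S T : hline S -> hline T -> x \in S -> x \in T -> (G S :&: G T)%VS != 0%VS.
  move=> hS hT xS xT; apply: (line_iso_meet_aux GG) => //.
  by apply: contraNneq x0 => cap0; rewrite -memv0 -cap0 memv_cap xS.
have cap12 := meet _ _ hS1 hS2 xS1 xS2.
pose x' := vpick (G S1 :&: G S2)%VS.
have x'0 : x' != 0 by rewrite vpick0.
have /memv_capP[x'1 x'2] : x' \in (G S1 :&: G S2)%VS by exact: memv_pick.
have conc A B C : hline A -> hline B -> hline C -> A != B -> x \in A -> x \in B ->
    x \in C -> x' \in G A -> x' \in G B -> ~~ (C <= A + B)%VS -> x' \in G C.
  move=> hA hB hC AB xA xB xC xA' xB' CAB.
  apply: (concurrent (A := G A) (B := G B)); rewrite ?(line_iso_le_add GG) ?meet //.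
  - exact: (GH A hA).1.
  - exact: (GH B hB).1.
  - exact: (GH C hC).1.
  - by rewrite (line_iso_inj GG).
exists x' => // S hS xS.
have [S_12|] := boolP (S <= S1 + S2)%VS; last exact: conc.
have [->//|SS1] := eqVneq S S1.
have d12 := hline_meet_dim hS1 hS2 xS1 xS2 x0.
have [|S4 hS4 [xS4 S4_12]] := hline_through_avoiding hS1 xS1 x0 (addvSl S1 S2).
  by apply: leq_ltn_trans d12 _.
have x'4 := conc _ _ _ hS1 hS2 hS4 S12 xS1 xS2 xS4 x'1 x'2 S4_12.
have S14 : S1 != S4 by apply: contraNneq S4_12 => <-; exact: addvSl.
apply: (conc S1 S4) => //; apply: contraNN S4_12 => S_14.
have e : (S1 + S == S1 + S4)%VS.
  rewrite eqEdim subv_add addvSl S_14 /=.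
  apply: leq_trans (hline_meet_dim hS1 hS4 xS1 xS4 x0) (hline_neq_dim _ _ _) => //.
  by rewrite eq_sym.
apply: subv_trans (_ : S1 + S <= _)%VS; last by rewrite subv_add addvSl.
by rewrite (eqP e) addvSr.
Qed.

(** Applying [pencil_image] to the inverse map at x' leads back to a vector on every hyperbolic line
    through x, hence to a multiple of x. *)
Lemma pencil_bij G G' x : line_iso G G' -> x != 0 ->
  exists2 x', x' != 0 & forall S, hline S -> (x' \in G S) = (x \in S).
Proof.
move=> GG x0; have [GH _ _] := GG.
have [x' x'0 x'P] := pencil_image GG x0; exists x' => // S hS.
have [x2 x20 x2P] := pencil_image (line_iso_sym GG) x'0.
have /vlineP[c x2c] : x2 \in <[x]>%VS.
  apply: mem_line_hlines x0 _ => T hT xT; have [hGT <-] := GH T hT.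
  by apply: x2P => //; apply: x'P.
have c0 : c != 0 by apply: contraNneq x20 => c0; rewrite x2c c0 scale0r.
apply/idP/idP; last exact: x'P.
move=> x'S; have [hGS <-] := GH S hS.
by have := x2P _ hGS x'S; rewrite x2c => cx; rewrite -[x](scalerK c0) memvZ.
Qed.

Lemma mem_lineP x y : x != 0 ->
  y \in <[x]>%VS <-> (forall S, hline S -> x \in S -> y \in S).
Proof.
move=> x0; split=> [/vlineP[c ->] S hS xS|]; first by rewrite memvZ.
exact: mem_line_hlines.
Qed.

(** Rephrases orthogonality of vectors as incidence with hyperbolic lines, the form in which it
    passes through the point map. *)
Lemma form_neq0P x y : x != 0 ->
  Omega x y != 0 <-> y \notin <[x]>%VS /\ exists S, [/\ hline S, x \in S & y \in S].
Proof.
move=> x0; split=> [xy|[xy [S [hS xS yS]]]]; last exact: hline_form hS xS yS x0 xy.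
split; first exact: (form_neq0_notin symplO).
exists (<[x]> + <[y]>)%VS; split; [exact: hline_pair|exact: mem_pairl|exact: mem_pairr].
Qed.

(** [h x] is an arbitrary vector spanning the image of the point of x. Its values at proportional
    vectors are chosen independently, so only the lines [<[h x]>] carry meaning. *)
Lemma point_map_ex G G' : line_iso G G' ->
  exists h : V -> V, [/\ forall x, (h x == 0) = (x == 0),
    forall x S, hline S -> (h x \in G S) = (x \in S),
    forall x y, (Omega (h x) (h y) == 0) = (Omega x y == 0) &
    forall y, exists x, y \in <[h x]>%VS].
Proof.
move=> GG; have [GH GH' _] := GG.
have [h hP] : {h : V -> V & forall x, (h x == 0) = (x == 0) /\
    forall S, hline S -> (h x \in G S) = (x \in S)}.
  apply: (@choice _ _ (fun x x' => (x' == 0) = (x == 0) /\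
    forall S, hline S -> (x' \in G S) = (x \in S))) => x.
  have [->|x0] := eqVneq x 0; first by exists 0; rewrite eqxx; split=> // S _; rewrite !mem0v.
  by have [x' x'0 x'P] := pencil_bij GG x0; exists x'; rewrite (negPf x'0).
have h0 x : (h x == 0) = (x == 0) by case: (hP x).
have hG x S : hline S -> (h x \in G S) = (x \in S) by case: (hP x) => _; apply.
have hlineP x y : x != 0 -> (h y \in <[h x]>%VS) = (y \in <[x]>%VS).
  move=> x0; have hx0 : h x != 0 by rewrite h0.
  apply/idP/idP => [/(mem_lineP _ hx0) hxy|/(mem_lineP _ x0) xy].
    apply/(mem_lineP _ x0) => S hS; rewrite -(hG x S hS) -(hG y S hS); apply: hxy.
    exact: (GH S hS).1.
  apply/(mem_lineP _ hx0) => S hS; have [hS' <-] := GH' S hS.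
  by rewrite !hG //; apply: xy.
exists h; split=> // [x y|y].
  have [->|x0] := eqVneq x 0.
    by have /eqP -> : h 0 == 0; rewrite ?h0 // !linear0l !eqxx.
  have hx0 : h x != 0 by rewrite h0.
  apply: negb_inj; apply/idP/idP.
    case/(form_neq0P _ hx0); rewrite hlineP // => xy [S [hS xS yS]].
    apply/(form_neq0P _ x0); split=> //; have [hS' GS] := GH' S hS.
    by exists (G' S); rewrite -(hG x _ hS') -(hG y _ hS') GS.
  case/(form_neq0P _ x0); rewrite -hlineP // => xy [S [hS xS yS]].
  apply/(form_neq0P _ hx0); split=> //; exists (G S); rewrite !hG //.
  by split=> //; exact: (GH S hS).1.
have [->|y0] := eqVneq y 0; first by exists 0; rewrite mem0v.
have [x x0 xP] := pencil_bij (line_iso_sym GG) y0.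
have hx0 : h x != 0 by rewrite h0.
exists x; apply: mem_line_hlines hx0 _ => S hS.
have [hS' GS] := GH' S hS; rewrite -{1}GS hG // -xP //.
Qed.
End PointMap.

(** * The fundamental theorem of projective geometry *)

Section FundamentalTheorem.
Variables (F : fieldType) (V : vectType F) (Omega : {skew_symmetric V}).
Hypothesis symplO : is_psymplectic Omega.
Hypothesis dimV : (10 <= \dim {:V})%N.
Variable h : V -> V.
Hypothesis h_eq0 : forall x, (h x == 0) = (x == 0).
Hypothesis h_form : forall x y, (Omega (h x) (h y) == 0) = (Omega x y == 0).
Hypothesis h_surj : forall y, exists x, y \in <[h x]>%VS.
Implicit Types (x y z d e w : V) (a b c : F).

Local Notation "U ^!" := (orthov Omega U) : vspace_scope.

Lemma mem_pair_orthov w y z :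
  (w \in ((<[y]> + <[z]>)^!)%VS) = (Omega w y == 0) && (Omega w z == 0).
Proof. by rewrite memvE orthovD -!memvE !mem_orthov_line. Qed.

(** A span is its own double orthogonal complement, so orthogonality determines it; [h_surj] serves
    to test [h x] against vectors that are only proportional to values of h. *)
Lemma h_pair x y z : (h x \in (<[h y]> + <[h z]>)%VS) = (x \in (<[y]> + <[z]>)%VS).
Proof.
rewrite -[(<[y]> + <[z]>)%VS](orthovK symplO) -[(<[h y]> + _)%VS](orthovK symplO).
apply/mem_orthovP/mem_orthovP => xP w; rewrite mem_pair_orthov.
  move=> /andP[wy wz]; apply/eqP; rewrite -h_form; apply/eqP/xP.
  by rewrite mem_pair_orthov !h_form wy.
have [t /vlineP[c ->]] := h_surj w; have [->|c0] := eqVneq c 0.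
  by rewrite scale0r linear0r.
rewrite !formZl !mulf_eq0 (negPf c0) !h_form /= => yz.
have xt : Omega (h x) (h t) = 0.
  by apply/eqP; rewrite h_form; apply/eqP/xP; rewrite mem_pair_orthov.
by rewrite formZr xt mulr0.
Qed.

Lemma h_line x y : (h x \in <[h y]>%VS) = (x \in <[y]>%VS).
Proof. by have := h_pair x y y; rewrite !addvv. Qed.

Lemma line_swap x y : y \in <[x]>%VS -> y != 0 -> x \in <[y]>%VS.
Proof.
move=> /vlineP[c ->]; rewrite scaler_eq0 negb_or => /andP[c0 _].
by apply/vlineP; exists c^-1; rewrite scalerK.
Qed.

Lemma line_trans x y z : x \in <[y]>%VS -> y \in <[z]>%VS -> x \in <[z]>%VS.
Proof. by move=> /vlineP[a ->] yz; rewrite memvZ. Qed.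

(* The map h is normalized on the affine hyperplane Omega(-, u) = 1, where it
   becomes x0 + d |-> h(x0) + lhyp d. *)
Section AffineChart.
Variables u x0 : V.
Hypothesis x0u : Omega x0 u = 1.

Definition hyp : {vspace V} := (<[u]>^!)%VS.

Lemma mem_hyp d : (d \in hyp) = (Omega d u == 0).
Proof. exact: mem_orthov_line. Qed.

Lemma hyp_form d : d \in hyp -> Omega d u = 0.
Proof. by rewrite mem_hyp => /eqP. Qed.

Lemma x0_hyp d : d \in hyp -> Omega (x0 + d) u = 1.
Proof. by move=> dH; rewrite formDl x0u (hyp_form dH) addr0. Qed.

Definition normalized z : V := (Omega (h z) (h u))^-1 *: h z.

Lemma normalized_form z : Omega z u = 1 -> Omega (normalized z) (h u) = 1.
Proof. by move=> zu; rewrite formZl mulVf // h_form zu oner_eq0. Qed.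

Lemma normalized_line z : Omega z u = 1 -> h z \in <[normalized z]>%VS.
Proof.
move=> zu; apply/vlineP; exists (Omega (h z) (h u)).
by rewrite scalerA divff ?scale1r // h_form zu oner_eq0.
Qed.

(** z - z' is the point at infinity of the affine line through z and z'. Its image lies in the span
    of the two normalized vectors and is orthogonal to h(u), so its two coefficients are
    opposite. *)
Lemma normalizedB z z' : Omega z u = 1 -> Omega z' u = 1 ->
  h (z - z') \in <[normalized z - normalized z']>%VS /\
  normalized z - normalized z' \in <[h (z - z')]>%VS.
Proof.
move=> zu z'u.
have [->|zz'] := eqVneq z z'.
  by have /eqP -> : h (z' - z') == 0; rewrite ?h_eq0 ?subrr ?mem0v.
have hB : h (z - z') \in <[normalized z - normalized z']>%VS.
  have : h (z - z') \in (<[h z]> + <[h z']>)%VS.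
    by rewrite h_pair memv_add ?memvN ?memv_line.
  have sub : (<[h z]> + <[h z']> <= <[normalized z]> + <[normalized z']>)%VS.
    by apply: addvS; rewrite -memvE normalized_line.
  move/(subvP sub)/memv_addP => [_ /vlineP[a ->] [_ /vlineP[b ->] hE]].
  have : Omega (h (z - z')) (h u) = 0.
    by apply/eqP; rewrite h_form formBl zu z'u subrr.
  rewrite hE formDl !(formZl _ _ (normalized _)) !normalized_form // !mulr1 => /eqP.
  rewrite addr_eq0 => /eqP ab; apply/vlineP; exists a.
  by rewrite ab scalerBr !scaleNr opprK addrC.
by split=> //; apply: line_swap hB _; rewrite h_eq0 subr_eq0.
Qed.

Definition lhyp d : V := normalized (x0 + d) - normalized x0.

Lemma lhyp0 : lhyp 0 = 0.
Proof. by rewrite /lhyp addr0 subrr. Qed.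

Lemma lhyp_form d : d \in hyp -> Omega (lhyp d) (h u) = 0.
Proof.
move=> dH; by rewrite /lhyp formBl !normalized_form ?x0_hyp // subrr.
Qed.

Lemma h_lhyp d : d \in hyp -> h d \in <[lhyp d]>%VS /\ lhyp d \in <[h d]>%VS.
Proof.
move=> dH; have := normalizedB (x0_hyp dH) x0u.
by rewrite (_ : x0 + d - x0 = d) // addrAC subrr add0r.
Qed.

Lemma lhyp_eq0 d : d \in hyp -> (lhyp d == 0) = (d == 0).
Proof.
move=> dH; apply/eqP/eqP => [l0|->]; last exact: lhyp0.
by have := (h_lhyp dH).1; rewrite l0 memv0 h_eq0 => /eqP.
Qed.

Lemma lhyp_line d e : d \in hyp -> e \in hyp ->
  (lhyp e \in <[lhyp d]>%VS) = (e \in <[d]>%VS).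
Proof.
move=> dH eH; apply/idP/idP => [led|ed].
  rewrite -h_line; apply: line_trans (h_lhyp eH).1 _.
  exact: line_trans led (h_lhyp dH).2.
apply: line_trans (h_lhyp eH).2 _; apply: line_trans _ (h_lhyp dH).1.
by rewrite h_line.
Qed.

Lemma lhypB d e : d \in hyp -> e \in hyp -> lhyp (d + e) - lhyp d \in <[lhyp e]>%VS.
Proof.
move=> dH eH; apply: line_trans _ (h_lhyp eH).1.
have deH : d + e \in hyp by rewrite memvD.
have [_] := normalizedB (x0_hyp deH) (x0_hyp dH).
rewrite (_ : x0 + (d + e) - (x0 + d) = e); last first.
  by rewrite addrA [x0 + d + e]addrC addrK.
by rewrite {2}/lhyp opprB {1}/lhyp [X in _ -> X \in _]addrA subrK.
Qed.

Lemma lin_indep2 x y a b a' b' : x != 0 -> y \notin <[x]>%VS ->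
  a *: x + b *: y = a' *: x + b' *: y -> a = a' /\ b = b'.
Proof.
move=> xn0 xy E; have Eb : (b - b') *: y = (a' - a) *: x.
  by rewrite !scalerBl; apply/eqP; rewrite subr_eq addrAC -E addrAC subrr add0r.
have bb : b = b'.
  apply/eqP; rewrite -subr_eq0; apply: contraNT xy => b0.
  by apply/vlineP; exists ((b - b')^-1 * (a' - a)); rewrite -scalerA -Eb scalerK.
split=> //; apply/eqP; rewrite eq_sym -subr_eq0; move/eqP: Eb.
by rewrite bb subrr scale0r eq_sym scaler_eq0 (negPf xn0) orbF.
Qed.

(* Parallelogram: d + e is on the lines through d and e parallel to e and d. *)
Lemma lhypD_indep d e : d \in hyp -> e \in hyp -> e \notin <[d]>%VS ->
  lhyp (d + e) = lhyp d + lhyp e.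
Proof.
move=> dH eH ed; have [->|d0] := eqVneq d 0; first by rewrite lhyp0 !add0r.
have [a Ea] := vlineP _ _ (lhypB dH eH).
have [b Eb] := vlineP _ _ (lhypB eH dH).
have := lin_indep2 (x := lhyp d) (y := lhyp e) (a := 1) (b := a) (a' := b) (b' := 1).
rewrite lhyp_eq0 // lhyp_line // => /(_ d0 ed); rewrite !scale1r => -[|_ a1].
  by rewrite addrC -Ea -Eb [e + d]addrC !subrK.
by rewrite -[LHS](subrK (lhyp d)) Ea a1 scale1r addrC.
Qed.

Lemma hyp_avoid d : exists2 m, m \in hyp & m \notin <[d]>%VS.
Proof.
apply/subvPn; apply/negP => /dimvS.
have := dim_orthov symplO <[u]>%VS; rewrite -/hyp !dim_vline.
by move: dimV; case: (u != 0); case: (d != 0) => /=; lia.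
Qed.

(** For dependent d and e, take m off their line and compute the image of d + e + m in two ways,
    using independent summands only. *)
Lemma lhypD d e : d \in hyp -> e \in hyp -> lhyp (d + e) = lhyp d + lhyp e.
Proof.
move=> dH eH; have [ed|] := boolP (e \in <[d]>%VS); last exact: lhypD_indep.
have [m mH md] := hyp_avoid d.
have em : e + m \notin <[d]>%VS.
  by apply: contraNN md => emd; rewrite -[m](addKr e) memvD ?memvN.
have me : m \notin <[e]>%VS by apply: contraNN md => me; apply: line_trans me ed.
have mde : m \notin <[d + e]>%VS.
  by apply: contraNN md => mde; apply: line_trans mde _; rewrite memvD ?memv_line.
apply: (addIr (lhyp m)); rewrite -(lhypD_indep (memvD dH eH) mH mde) -addrA.
by rewrite (lhypD_indep dH (memvD eH mH) em) (lhypD_indep eH mH me) addrA.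
Qed.

Lemma lhypZ_ex d c : d \in hyp -> exists s, lhyp (c *: d) = s *: lhyp d.
Proof.
move=> dH; apply/vlineP; rewrite lhyp_line ?memvZ //; exact: memv_line.
Qed.

(** The factor could depend on d. For independent d and e, expanding the image of c(d + e) equates
    their factors; dependent vectors are compared through a third one. *)
Lemma chart_scaling : exists s : F -> F,
  forall d c, d \in hyp -> lhyp (c *: d) = s c *: lhyp d.
Proof.
have [s sP] : {s : V * F -> F & forall dc, dc.1 \in hyp ->
    lhyp (dc.2 *: dc.1) = s dc *: lhyp dc.1}.
  apply: (@choice _ _ (fun dc t => dc.1 \in hyp -> lhyp (dc.2 *: dc.1) = t *: lhyp dc.1)).
  move=> [d c] /=; have [dH|_] := boolP (d \in hyp); last by exists 0.
  by have [t ->] := lhypZ_ex c dH; exists t.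
have s_indep d e c : d \in hyp -> e \in hyp -> d != 0 -> e \notin <[d]>%VS ->
    s (d, c) = s (e, c).
  move=> dH eH d0 ed; have deH : d + e \in hyp by rewrite memvD.
  have [] := @lin_indep2 (lhyp d) (lhyp e) (s (d + e, c)) (s (d + e, c)) (s (d, c)) (s (e, c)).
  - by rewrite lhyp_eq0.
  - by rewrite lhyp_line.
  - have /= Ed := sP (d, c) dH; have /= Ee := sP (e, c) eH.
    have /= := sP (d + e, c) deH.
    by rewrite scalerDr !lhypD ?memvZ // Ed Ee => ->; rewrite -scalerDr.
  by move=> <-.
have [d dH d0] : exists2 d, d \in hyp & d != 0.
  by have [d dH d0] := hyp_avoid 0; exists d; rewrite // memv0 in d0.
exists (fun c => s (d, c)) => e c eH.
rewrite (sP (e, c) eH) /=; have [->|e0] := eqVneq e 0; first by rewrite lhyp0 !scaler0.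
congr (_ *: _); have [ed|ed] := boolP (e \in <[d]>%VS); last by rewrite (s_indep d e).
have [m mH md] := hyp_avoid d.
rewrite (s_indep d m) // (s_indep e m) //.
by apply: contraNN md => me; apply: line_trans me ed.
Qed.

Lemma chart_rmorphism : exists s : {rmorphism F -> F},
  forall d c, d \in hyp -> lhyp (c *: d) = s c *: lhyp d.
Proof.
have [s sP] := chart_scaling.
have [d dH] := hyp_avoid 0; rewrite memv0 -lhyp_eq0 // => ld0.
have inj a b : a *: lhyp d = b *: lhyp d -> a = b.
  move/eqP; rewrite -subr_eq0 -scalerBl scaler_eq0 (negPf ld0) orbF subr_eq0.
  by move/eqP.
have sB : zmod_morphism s.
  move=> a b; apply: inj; rewrite -sP // scalerBl -scaleN1r scalerA mulN1r.
  have sN : s (- b) *: lhyp d = - (s b *: lhyp d).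
    apply/eqP; rewrite -addr_eq0 -!sP // -lhypD ?memvZ //.
    by rewrite -scalerDl addNr scale0r lhyp0.
  by rewrite lhypD ?memvZ // !sP // sN scalerBl.
have sM : monoid_morphism s.
  split=> [|a b]; apply: inj; first by rewrite -sP // !scale1r.
  by rewrite -sP // -!scalerA -!sP ?memvZ.
pose s' : {rmorphism F -> F} := HB.pack s (GRing.isZmodMorphism.Build F F s sB)
  (GRing.isMonoidMorphism.Build F F s sM).
by exists s' => e c eH; rewrite sP.
Qed.

Lemma ftpg_chart : exists (s : {rmorphism F -> F}) (L : V -> V),
  [/\ bijective s, bijective L, linear_for (s \; *:%R) L & forall z, L z \in <[h z]>%VS].
Proof.
have [s sP] := chart_rmorphism.
(* [p] is the projection onto [hyp] along [x0], so [L] is the semilinear extension of [lhyp] that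
   sends [x0] to [X0]. *)
pose X0 := normalized x0; pose p z := z - Omega z u *: x0.
have pH z : p z \in hyp by rewrite mem_hyp formBl formZl x0u mulr1 subrr.
pose L z := s (Omega z u) *: X0 + lhyp (p z).
have X0u : Omega X0 (h u) = 1 by exact: normalized_form.
have lin : linear_for (s \; *:%R) L.
  move=> a z w; rewrite /L /= formDl formZl rmorphD rmorphM scalerDl scalerDr scalerA.
  rewrite -[in RHS]sP // -addrA [in RHS]addrACA -lhypD ?memvZ // addrA.
  congr (_ + lhyp _); rewrite /p formDl formZl scalerDl scalerBr scalerA opprD.
  exact: addrACA.
have L0 : L 0 = 0.
  by rewrite /L /p linear0l rmorph0 !scale0r subrr lhyp0 addr0.
have LZ a z : L (a *: z) = s a *: L z by have := lin a z 0; rewrite !addr0 L0 addr0.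
have LD z w : L (z + w) = L z + L w.
  by have := lin 1 z w; rewrite /= rmorph1 !scale1r.
have L_hyp d : d \in hyp -> L d = lhyp d.
  by move=> /hyp_form dH; rewrite /L /p dH rmorph0 !scale0r add0r subr0.
have L_x0 : L x0 = X0.
  by rewrite /L /p x0u rmorph1 !scale1r subrr lhyp0 addr0.
have L_aff d : d \in hyp -> L (x0 + d) = normalized (x0 + d).
  by move=> dH; rewrite LD L_x0 L_hyp // /lhyp addrC subrK.
have Lh z : L z \in <[h z]>%VS /\ (L z == 0) = (z == 0).
  have [zu|zu] := eqVneq (Omega z u) 0.
    have zH : z \in hyp by rewrite mem_hyp zu.
    by rewrite L_hyp //; split; [case: (h_lhyp zH) | exact: lhyp_eq0].
  pose c := Omega z u; pose d := c^-1 *: z - x0.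
  have dH : d \in hyp by rewrite mem_hyp formBl formZl x0u mulVf // subrr.
  have zE : z = c *: (x0 + d) by rewrite addrC subrK scalerA divff // scale1r.
  have xdu := x0_hyp dH; have hn := normalized_line xdu.
  have hxd : h (x0 + d) != 0.
    rewrite h_eq0; apply: contra_eq_neq xdu => ->.
    by rewrite linear0l eq_sym oner_eq0.
  have nn : normalized (x0 + d) \in <[h (x0 + d)]>%VS by apply: line_swap hn hxd.
  have n0 : normalized (x0 + d) != 0.
    by apply: contraNneq hxd => n0; rewrite n0 memv0 in hn.
  split.
    rewrite {1}zE LZ L_aff // memvZ // (line_trans nn) // h_line.
    by rewrite zE; apply: line_swap (memvZ _ (memv_line _)) _; rewrite -zE (form_neq0_l zu).
  rewrite {1}zE LZ L_aff // scaler_eq0 (negPf n0) orbF fmorph_eq0 (negPf zu).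
  by rewrite (negPf (form_neq0_l zu)).
have L_surj_line y : exists z b, y = b *: L z.
  have [z /vlineP[a yz]] := h_surj y; exists z.
  have [z0|z0] := eqVneq z 0.
    by exists 0; move: yz; have /eqP -> : h z == 0; rewrite ?h_eq0 ?z0 // scaler0 scale0r.
  have [Lz Lz0] := Lh z; have /vlineP[b hb] := line_swap Lz (etrans (congr1 negb Lz0) z0).
  by exists (a * b); rewrite -scalerA -hb.
(* The vector [X0 + c *: lhyp d] is a multiple of some [L z]. Scaled into the chart, z becomes
   [x0 + t *: d], and comparing directions gives s(t) = c. *)
have s_surj c : exists t, s t = c.
  have [d dH] := hyp_avoid 0; rewrite memv0 => d0.
  have ld0 : lhyp d != 0 by rewrite lhyp_eq0.
  have [z [b zb]] := L_surj_line (X0 + c *: lhyp d).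
  have b_zu : b * s (Omega z u) = 1.
    have := congr1 (Omega^~ (h u)) zb; rewrite formDl (formZl _ c) lhyp_form // mulr0 addr0 X0u.
    by rewrite (formZl _ b) formDl (formZl _ (s _) X0) X0u mulr1 (lhyp_form (pH z)) addr0.
  have zu : Omega z u != 0.
    by apply: contra_eq_neq b_zu => ->; rewrite rmorph0 mulr0 eq_sym oner_eq0.
  have bE : b = s (Omega z u)^-1.
    by rewrite fmorphV -[RHS]mul1r -b_zu mulfK // fmorph_eq0.
  pose z1 := (Omega z u)^-1 *: z; have z1u : Omega z1 u = 1 by rewrite formZl mulVf.
  have : c *: lhyp d = lhyp (p z1).
    apply: (addrI X0); rewrite zb bE -LZ -/z1.
    by rewrite {1}/L z1u rmorph1 scale1r.
  have [->|c0] := eqVneq c 0; first by exists 0; rewrite rmorph0.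
  move=> cE; have : p z1 \in <[d]>%VS.
    by rewrite -lhyp_line // -cE memvZ ?memv_line.
  case/vlineP => t pt; exists t; move/eqP: cE; rewrite pt sP // -subr_eq0 -scalerBl.
  by rewrite scaler_eq0 (negPf ld0) orbF subr_eq0 => /eqP.
have [s' s'K] := choice s_surj.
exists s, L; split=> //; last by move=> z; case: (Lh z).
  by exists s' => // a; apply: (fmorph_inj s); rewrite s'K.
have L_surj y : exists z, L z = y.
  by have [z [b ->]] := L_surj_line y; exists (s' b *: z); rewrite LZ s'K.
have [L' L'K] := choice L_surj.
have L_inj : injective L.
  move=> z w zw; apply/eqP; rewrite -subr_eq0 -(Lh _).2 LD -scaleN1r LZ rmorphN1.
  by rewrite scaleN1r zw subrr.
by exists L' => // z; apply: L_inj; rewrite L'K.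
Qed.

End AffineChart.

Lemma ftpg : exists (s : {rmorphism F -> F}) (L : V -> V),
  [/\ bijective s, bijective L, linear_for (s \; *:%R) L & forall z, L z \in <[h z]>%VS].
Proof.
have [x [y xy]] := ex_form_neq0 symplO (leq_trans (isT : 0 < 10)%N dimV).
apply: (@ftpg_chart y ((Omega x y)^-1 *: x)).
by rewrite formZl mulVf.
Qed.

Lemma ftpg_form : exists l : V -> V, GammaSp Omega l /\ forall z, l z \in <[h z]>%VS.
Proof.
have [s [L [s_bij L_bij lin Lh]]] := ftpg.
have L0 : L 0 = 0.
  by apply/eqP; have := Lh 0; have /eqP -> : h 0 == 0; rewrite ?h_eq0 // memv0.
have LZ a z : L (a *: z) = s a *: L z by have := lin a z 0; rewrite !addr0 L0 addr0.
have LD z w : L (z + w) = L z + L w.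
  by have := lin 1 z w; rewrite /= rmorph1 !scale1r.
have L_orth x y : Omega x y = 0 -> Omega (L x) (L y) = 0.
  move/eqP; rewrite -h_form => /eqP hxy.
  have /vlineP[a ->] := Lh x; have /vlineP[b ->] := Lh y.
  by rewrite formZl formZr hxy !mulr0.
(* The prospective multiplier. For fixed x it does not depend on y, because some y - a z is
   orthogonal to x; by symmetry the same holds in the other argument. *)
pose r x y := Omega (L x) (L y) / s (Omega x y).
have r_sym x y : r x y = r y x.
  by rewrite /r [Omega (L y) _]formC [Omega y x]formC rmorphN invrN mulrNN.
have r_row x y z : Omega x y != 0 -> Omega x z != 0 -> r x y = r x z.
  move=> xy xz; pose a := Omega x y / Omega x z.
  have : Omega x (y + - a *: z) = 0.
    by rewrite formDr formZr mulNr divfK // subrr.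
  move/L_orth; rewrite LD LZ formDr formZr rmorphN mulNr => /eqP.
  rewrite subr_eq0 => /eqP; rewrite /r => ->.
  by rewrite /a rmorphM fmorphV; field; rewrite !fmorph_eq0 xy xz.
have r_const x y u v : Omega x y != 0 -> Omega u v != 0 -> r x y = r u v.
  (* Two pairs are joined through a common z that is orthogonal to neither x nor u: one of y, v and
     y + v will do. *)
  move=> xy uv; have [z xz uz] : exists2 z, Omega x z != 0 & Omega u z != 0.
    have [uy|uy] := eqVneq (Omega u y) 0; last by exists y.
    have [xv|xv] := eqVneq (Omega x v) 0; last by exists v.
    by exists (y + v); rewrite formDr ?uy ?xv ?addr0 ?add0r.
  rewrite (r_row x y z) // r_sym (r_row z x u) 1?form_eq0C // r_sym.
  exact: r_row.
have [x [y xy]] := ex_form_neq0 symplO (leq_trans (isT : 0 < 10)%N dimV).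
exists L; split=> //; exists s; split=> //; exists (r x y).
  rewrite mulf_neq0 ?invr_eq0 ?fmorph_eq0 //.
  have L_neq0 z : z != 0 -> L z != 0.
    apply: contraNneq => Lz; have := bij_inj L_bij.
    by move=> /(_ z 0); rewrite Lz L0 => ->.
  have hL z : z != 0 -> h z \in <[L z]>%VS.
    by move=> z0; apply: line_swap (Lh z) (L_neq0 z z0).
  have x0 : x != 0 by exact: form_neq0_l xy.
  have y0 : y != 0 by apply: contraNneq xy => ->; rewrite linear0r.
  apply: contraNneq xy => Lxy; rewrite -h_form.
  have /vlineP[a ->] := hL x x0; have /vlineP[b ->] := hL y y0.
  by rewrite formZl formZr Lxy !mulr0.
move=> z w; have [zw|zw] := eqVneq (Omega z w) 0; first by rewrite L_orth ?zw ?rmorph0 ?mulr0.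
by rewrite (r_const x y z w) // /r divfK // fmorph_eq0.
Qed.
End FundamentalTheorem.

(** * The transformation of H_k *)

Section Transport.
Variables (F : fieldType) (V : vectType F) (n k : nat).
Hypothesis dimV : \dim {:V} = (2 * n)%N.
Variable Omega : {skew_symmetric V}.
Hypothesis symplO : is_psymplectic Omega.
Implicit Types (U : {vspace V}) (f g : {vspace V} -> {vspace V}).

Lemma base_maps_of_bijection f :
  set_bij (Hset Omega k) (Hset Omega k) f -> preserves_base_subsets Omega n k f ->
  exists g, base_map Omega n k f g /\ base_map Omega n k g f.
Proof.
move=> [fun_f inj_f surj_f] [base_f base_g].
have [g gP] : {g : {vspace V} -> {vspace V} &
    forall U, Hset Omega k U -> Hset Omega k (g U) /\ f (g U) = U}.
  apply: (@choice _ _ (fun U W => Hset Omega k U -> Hset Omega k W /\ f W = U)) => U.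
  have [hU|nU] := pselect (Hset Omega k U); last by exists U.
  by have [W hW <-] := surj_f U hU; exists W.
have fK U : Hset Omega k U -> g (f U) = U.
  move=> hU; have [hW fW] := gP _ (fun_f U hU).
  by apply: inj_f => //; exact: mem_set.
exists g; split; split=> [U hU|S fS].
- exact: fK.
- have [|T fT ->] := (is_base_subsetP symplO dimV k (f @` ksums k S)%classic).1;
    last by exists T.
  by apply: base_f; apply/(is_base_subsetP symplO dimV); exists S.
- by case: (gP U hU).
have [|T fT eT] :=
  (is_base_subsetP symplO dimV k (Hset Omega k `&` f @^-1` ksums k S)%classic).1.
  by apply: base_g; apply/(is_base_subsetP symplO dimV); exists S.
exists T => //; rewrite -eT; apply/seteqP; split=> U /=.
  case=> W SW <-; have hW := ksums_Hset fS SW; have [hgW fgW] := gP W hW.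
  by split=> //=; rewrite fgW.
by move=> [hU SU]; exists (f U) => //; exact: fK.
Qed.

(** As [l z] and [h z] span the same point, [l] maps each hyperbolic line T onto G(T); additivity of
    [l] extends this to sums. *)
Lemma semilinear_image_sum (l : V -> V) (h : V -> V) (G : {vspace V} -> {vspace V})
    (S : 'I_n -> {vspace V}) (I : {set 'I_n}) :
  GammaSp Omega l -> frame Omega S ->
  (forall x, (h x == 0) = (x == 0)) -> (forall z, l z \in <[h z]>%VS) ->
  (forall x T, Hset Omega 1 T -> (h x \in G T) = (x \in T)) ->
  ([set x | x \in sumI (G \o S) I] = l @` [set x | x \in sumI S I])%classic.
Proof.
move=> [s [_ [l' lK l'K] lin _]] fS h_eq0 lh hG.
have l0 : l 0 = 0.
  by apply/eqP; have := lh 0; have /eqP -> : h 0 == 0; rewrite ?h_eq0 // memv0.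
have lD z w : l (z + w) = l z + l w.
  by have := lin 1 z w; rewrite /= rmorph1 !scale1r.
have l_sum (v : 'I_n -> V) : l (\sum_(i in I) v i) = \sum_(i in I) l (v i).
  exact: (big_morph l lD l0).
have lG z T : Hset Omega 1 T -> (l z \in G T) = (z \in T).
  move=> hT; rewrite -(hG z T hT); have [->|z0] := eqVneq z 0.
    by have /eqP -> : h 0 == 0; rewrite ?h_eq0 // l0 !mem0v.
  have lz0 : l z != 0 by apply: contraNneq z0 => lz; apply/eqP/(can_inj lK); rewrite lz l0.
  have hl := line_swap (lh z) lz0.
  apply/idP/idP => inG; last by have /vlineP[a ->] := lh z; rewrite memvZ.
  by have /vlineP[a ->] := hl; rewrite memvZ.
apply/seteqP; split=> y /=.
  case/memv_sumP => v vG ->; exists (\sum_(i in I) l' (v i)).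
    apply: memv_sumr => i iI; rewrite -lG ?l'K; first exact: vG.
    exact: frame_hline.
  by rewrite l_sum; apply: eq_bigr => i _; rewrite l'K.
case=> _ /memv_sumP[v vS ->] <-; rewrite l_sum; apply: memv_sumr => i iI.
by rewrite lG ?vS //; apply: frame_hline.
Qed.
End Transport.

Local Open Scope classical_set_scope.
Local Open Scope ring_scope.

Theorem theorem1 (F : fieldType) (V : vectType F) (n k : nat)
    (dimV : \dim {:V} = (2 * n)%N)
    (Omega : {skew_symmetric V}) (symplO : is_psymplectic Omega)
    (k_gt0 : (1 <= k)%N) (k_lt : (k <= n - 1)%N)
    (n_neq : n <> (2 * k)%N) (max_ge5 : (5 <= maxn k (n - k))%N)
    (f : {vspace V} -> {vspace V})
    (f_bij : set_bij (Hset Omega k) (Hset Omega k) f)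
    (f_base : preserves_base_subsets Omega n k f) :
  exists l : V -> V, GammaSp Omega l /\
    forall U : {vspace V}, Hset Omega k U ->
      [set x | x \in f U] = l @` [set x | x \in U].
Proof.
have kn : (k < n)%N by lia.
have dim10 : (10 <= \dim {:V})%N by rewrite dimV; move: max_ge5; lia.
have [g [bf bg]] := base_maps_of_bijection dimV symplO f_bij f_base.
have [G [G' [GH GH' GP fG]]] :=
  line_bijection symplO dimV k_gt0 kn n_neq max_ge5 bf bg.
have GG : line_iso Omega G G' by [].
have [h [h_eq0 hG h_form h_surj]] := point_map_ex symplO dim10 GG.
have [l [l_gamma lh]] := ftpg_form symplO dim10 h_eq0 h_form h_surj.
exists l; split=> // U /fG [S [I [fS -> ->]]].
exact: semilinear_image_sum l_gamma fS h_eq0 lh hG.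
Qed.
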